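(* The number $\Gamma_{i}^{\left[s\atop{s\atop s}\right]\times k}$ of rank $i$ triple persymmetric $3s\times k$ matrices over $\mathbb{F}_2$ is \begin{equation*} \begin{cases} 1 & \text{if } i=0,\\ 105\cdot 2^{4i-6} - 21\cdot 2^{3i-5} & \text{if } 1\leq i\leq s-1,\ k\geq i+1,\\ 7\cdot 2^{k+s-1} - 7\cdot 2^{2s} + 105\cdot 2^{4s-6} - 21\cdot 2^{3s-5} & \text{if } i=s,\ k\geq s+1,\ s\geq 1,\\ 147\cdot(5\cdot 2^{j-1}-1)\cdot 2^{k+s+3j-6} + 21\cdot\big[5\cdot 2^{4s+4j-6} - 2^{3s+3j-5} - (155\cdot 2^{j-1}-35)\cdot 2^{2s+4j-7}\big] & \text{if } i=s+j,\ 1\leq j\leq s-1,\ k\geq s+j+1,\\ 7\cdot 2^{2k+2s-2} + 21\cdot\big[35\cdot 2^{k+5s-7} - 39\cdot 2^{k+4s-6}\big] + 7\cdot\big[15\cdot 2^{8s-6} - 465\cdot 2^{7s-8} + 349\cdot 2^{6s-7}\big] & \text{if } i=2s,\ k\geq 2s+1,\\ 105\cdot\big(2^{2k+2s+4j-2} + 7\cdot 2^{k+5s+4j-3} - 31\cdot 2^{k+4s+5j-3}\big) + 105\cdot\big(2^{8s+4j-2} - 31\cdot 2^{7s+5j-3} + 93\cdot 2^{6s+6j-3}\big) & \text{if } i=2s+1+j,\ k\geq 2s+2+j,\ 0\leq j\leq s-2,\\ 2^{3k+3s-3} - 7\cdot 2^{2k+6s-6} + 7\cdot 2^{k+9s-8}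 - 2^{12s-9} & \text{if } i=3s,\ k\geq 3s. \end{cases} \end{equation*} Moreover \begin{equation*} \Gamma_{i}^{\left[s\atop{s\atop s}\right]\times i} = \begin{cases} 2^{3s+3i-3} - 7\cdot 2^{4i-6} + 3\cdot 2^{3i-5} & \text{if } 1\leq i\leq s+1,\\ 2^{6s+3j-3} + 7\cdot 2^{2s+5j-8} - 7\cdot 2^{2s+4j-7} - 7\cdot 2^{4s+4j-6} + 3\cdot 2^{3s+3j-5} & \text{if } i=s+j,\ 1\leq j\leq s+1,\\ 2^{9s+3j} - 7\cdot 2^{8s+4j-2} + 7\cdot 2^{7s+5j-3} - 2^{6s+6j-3} & \text{if } i=2s+1+j,\ 0\leq j\leq s-1. \end{cases} \end{equation*} For $0\leq j\leq s-2$, $k\geq 2s+2+j$: $\Gamma_{2s+1+j}^{\left[s\atop{s\atop s}\right]\times k} = 16^{3j}\cdot\Gamma_{2(s-j)+1}^{\left[s-j\atop{s-j\atop s-j}\right]\times(k-3j)}$. For $0\leq j\leq s-1$: $\Gamma_{2s+1+j}^{\left[s\atop{s\atop s}\right]\times(2s+1+j)} = 16^{3j}\cdot\Gamma_{2(s-j)+1}^{\left[s-j\atop{s-j\atop s-j}\right]\times(2(s-j)+1)}$. For $k\geq 3s$: $\Gamma_{3s}^{\left[s\atop{s\atop s}\right]\times k} = 16^{3(s-1)}\cdot\Gamma_{3}^{\left[1\atop{1\atop 1}\right]\times(k-3(s-1))}$.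
   Context: $\Gamma_{i}^{\left[a\atop{b\atop c}\right]\times k}$ denotes the number of rank $i$ matrices over $\mathbb{F}_2$ of the form $\left[\frac{A}{\frac{B}{C}}\right]$ where $A$, $B$, $C$ are persymmetric matrices over $\mathbb{F}_2$ of sizes $a\times k$, $b\times k$, $c\times k$ (a matrix $[\alpha_{i,j}]$ is persymmetric if $\alpha_{i,j}=\alpha_{r,s}$ whenever $i+j=r+s$). Here $a=b=c=s$. *)

(* Defs.v *)
From mathcomp Require Import all_boot all_order all_algebra.

Set Implicit Arguments.
Unset Strict Implicit.
Unset Printing Implicit Defensive.

Import Order.TTheory GRing.Theory Num.Theory.
Local Open Scope ring_scope.

Definition persymmetric (m n : nat) (A : 'M['F_2]_(m, n)) : bool :=
  [forall i : 'I_m, forall j : 'I_n, forall r : 'I_m, forall t : 'I_n,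
     (i + j == r + t)%N ==> (A i j == A r t)].

(* M is the block matrix with A on top of B on top of C. *)
Definition triple_persymmetric (a b c k : nat)
    (M : 'M['F_2]_(a + (b + c), k)) : bool :=
  [&& persymmetric (usubmx M),
      persymmetric (usubmx (dsubmx M))
    & persymmetric (dsubmx (dsubmx M))].

(* Rank index first: [Gamma i a b c k] has subscript i, block heights a, b, c
   and width k. *)
Definition Gamma (i a b c k : nat) : nat :=
  #|[set M : 'M['F_2]_(a + (b + c), k) |
      triple_persymmetric M && (\rank M == i)]|.

(* Main.v *)
Require Import Defs.
From mathcomp Require Import all_boot all_order all_algebra mxabelem.
From mathcomp Require Import zify ring lra.

(** A triple persymmetric [3s x k] matrix is a sequence [t] of [s + k - 1] vectors
    of F_2^3, and its rank is the dimension spanned by the [k] windows of length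
    [s] of [t].  Such a [t] is an extension of O(N + 1) by O^3 on P^1, N = s + k - 1;
    the splitting type e1 >= e2 >= e3 >= e4 of the middle bundle has sum N + 1 and
    gives all the window ranks: rank_s(t) + s = sum_j min(e_j, s).  Prepending a
    vector to [t] raises one part by 1, and the number of vectors raising a given
    part depends only on the type and on the part raised last (the mark).  This
    Markov chain has an explicit product-form solution.  Subtracting 1 from all
    nonzero parts gives a recursion from height [s] to height [s + 1] between the
    numbers of [t] with given rank and given dimension of the span of the entries
    of [t]; the closed forms follow by induction on [s]. *)

Set Implicit Arguments.
Unset Strict Implicit.
Unset Printing Implicit Defensive.
Import Order.TTheory GRing.Theory Num.Theory.
Local Open Scope ring_scope.

(** * Ranks of matrices of windows *)

Section RankLemmas.
Variable F : finFieldType.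

(** No bundle occurs in the formal proof: types are built by the recursion [profile], and the
    invariant [describes] replaces the geometry. It propagates because asking that the new first
    window depend on the later ones is a linear system in the new vector: it is solvable exactly
    when the first window of the old sequence, one vector shorter, is dependent, and then its
    solutions form a coset whose size is a power of 2. The type alone does not decide solvability;
    this is the information stored in the mark. In the height recursion, the weight of a type is
    multiplied by a factor that depends on its number of zero parts, so the recursion is run on
    strata instead of on [Gamma]. The dimension of the span is the number of nonzero parts minus 1,
    and the system is triangular: stratum [h] at height s + 1 involves strata 0 to [h] at height s,
    with width and rank both lowered by [h]. Stratum [h] is empty above rank h s, and this is where
    the case distinctions on the rank come from. *)

Lemma mxrank_col_row (m n : nat) (u : 'rV[F]_n) (A : 'M[F]_(m, n)) :
  \rank (col_mx u A) = (\rank A + ~~ (u <= A)%MS)%N.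
Proof.
rewrite -addsmxE; case: (boolP (u <= A)%MS) => uA /=.
  by rewrite addn0 (addsmx_idPr uA).
have := mxrank_sum_cap u A.
have -> : \rank (u :&: A)%MS = 0%N.
  apply/eqP; rewrite -leqn0 -ltnS; apply: leq_trans (rank_leq_row u).
  rewrite ltn_neqAle mxrankS ?capmxSl // andbT.
  apply: contra uA => /eqP e; apply: submx_trans (capmxSr u A).
  by rewrite -(mxrank_leqif_sup (capmxSl u A)) e.
have -> : \rank u = 1%N.
  apply/eqP; rewrite rank_rV eqb1; apply: contra uA => /eqP ->; exact: sub0mx.
lia.
Qed.

(** Multiplication by [A] on the left kernel of [B] has the left kernel of [row_mx A B] as its
    kernel; rank-nullity is applied to both. *)
Lemma rank_ker_mul (k m n : nat) (A : 'M[F]_(k, m)) (B : 'M[F]_(k, n)) :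
  \rank (kermx B *m A) = (\rank (row_mx A B) - \rank B)%N.
Proof.
have := mxrank_mul_ker (kermx B) A.
have -> : \rank (kermx B :&: kermx A)%MS = \rank (kermx (row_mx A B)).
  apply: eqmx_rank; apply/andP; split.
    apply/sub_kermxP; rewrite mul_mx_row.
    have /sub_kermxP -> := capmxSl (kermx B) (kermx A).
    have /sub_kermxP -> := capmxSr (kermx B) (kermx A).
    by rewrite row_mx0.
  have /sub_kermxP := submx_refl (kermx (row_mx A B)).
  rewrite mul_mx_row -[0]row_mx0 => /eq_row_mx [hA hB].
  by rewrite sub_capmx; apply/andP; split; apply/sub_kermxP.
rewrite !mxrank_ker.
have := rank_leq_row (row_mx A B); have := rank_leq_row B.
lia.
Qed.

(** If b = x0 B, the completions are the coset x0 A + (ker B) A. *)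
Lemma card_row_completions (k m n : nat) (b : 'rV[F]_n) (A : 'M[F]_(k, m)) (B : 'M[F]_(k, n)) :
  #|[set v : 'rV[F]_m | (row_mx v b <= row_mx A B)%MS]| =
  (if (b <= B)%MS then #|F| ^ (\rank (row_mx A B) - \rank B) else 0)%N.
Proof.
case: ifPn => [/submxP [x0 hx0] | hb]; last first.
  apply/eqP; rewrite cards_eq0; apply/eqP/setP => v; rewrite !inE.
  apply/negbTE; apply: contra hb => /submxP [x].
  by rewrite mul_mx_row => /eq_row_mx [_ ->]; apply: submxMl.
rewrite -rank_ker_mul -card_rowg.
rewrite -[RHS](card_imset _ (@addIr _ (x0 *m A))); apply: eq_card => v.
rewrite inE; apply/idP/imsetP.
  case/submxP => x; rewrite mul_mx_row => /eq_row_mx [hv hb].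
  exists (v - x0 *m A); last by rewrite subrK.
  rewrite mem_rowg hv -mulmxBl; apply: submxMr; apply/sub_kermxP.
  by rewrite mulmxBl -hb -hx0 subrr.
case=> w; rewrite mem_rowg => /submxP [y ->] ->.
apply/submxP; exists (y *m kermx B + x0).
rewrite mul_mx_row !mulmxDl -hx0 -(mulmxA y _ A) -(mulmxA y _ B).
have /sub_kermxP -> := submx_refl (kermx B).
by rewrite mulmx0 add0r.
Qed.

End RankLemmas.

Local Notation V3 := 'rV['F_2]_3.

Fixpoint window_width (s : nat) : nat := if s is s'.+1 then 3 + window_width s' else 0.

(** Row j is the concatenation of t_j, ..., t_(j+s-1). The recursion splits off the first vector of
    every window, which gives the shape [row_mx v b] required by [card_row_completions]. *)
Fixpoint windows (t : seq V3) (k s : nat) : 'M['F_2]_(k, window_width s) :=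
  if s is s'.+1 then row_mx (\matrix_(j < k) nth 0 t j) (windows (behead t) k s')
  else 0.

Definition wrank s t := \rank (windows t (size t + 1 - s) s).

Definition first_dep s t :=
  (s <= size t)%N && (windows t 1 s <= windows (behead t) (size t - s) s)%MS.

Lemma windowsS t k s :
  windows t (1 + k) s = col_mx (windows t 1 s) (windows (behead t) k s).
Proof.
elim: s t k => [|s IH] t k /=; first by apply/matrixP => i [].
have -> : \matrix_(j < 1 + k) nth 0 t j = 
   col_mx (\matrix_(j < 1) nth 0 t j) (\matrix_(j < k) nth 0 (behead t) j) :> 'M['F_2]_(1 + k, 3).
  apply/row_matrixP => j; rewrite rowK; case: (split_ordP j) => j' ->.
    by rewrite rowKu rowK (ord1 j').
  by rewrite rowKd rowK nth_behead.
by rewrite (IH (behead t) k) -block_mxEh -block_mxEv.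
Qed.


Lemma row_windows t k s (j : 'I_k) : row j (windows t k s) = windows (drop j t) 1 s.
Proof.
elim: s t => [|s IH] t /=; first by apply/matrixP => i [].
rewrite row_row_mx IH rowK -drop1 -[behead _]drop1 !drop_drop (addnC j 1); congr row_mx.
by apply/row_matrixP => i; rewrite rowK (ord1 i) nth_drop addn0; apply/rowP => x; rewrite !mxE.
Qed.

Lemma windows_subS t k k' s : (k <= k')%N -> (windows t k s <= windows t k' s)%MS.
Proof.
move=> kk; apply/row_subP => j; rewrite row_windows.
by have := row_sub (widen_ord kk j) (windows t k' s); rewrite row_windows.
Qed.

(** [P] forgets the last vector of every window. *)
Lemma windows_trunc s : exists P : 'M['F_2]_(window_width s.+1, window_width s),
  forall t k, windows t k s = windows t k s.+1 *m P.
Proof.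
elim: s => [|s [P hP]]; first by exists 0 => t k; apply/matrixP => i [].
exists (block_mx 1%:M 0 0 P) => t k.
rewrite [windows t k s.+2]/= -/(windows t k s.+1).
rewrite (mul_row_block (\matrix_(j < k) nth 0 t j) (windows (behead t) k s.+1)).
by rewrite mulmx1 !mulmx0 addr0 add0r -hP.
Qed.

(** A linear relation between windows survives truncation. The dependent lengths therefore form an
    initial segment, which a single number can encode. *)
Lemma first_depS s t : first_dep s.+1 t -> first_dep s t.
Proof.
rewrite /first_dep; case/andP => hs h; rewrite ltnW //=.
have [P hP] := windows_trunc s; rewrite hP.
apply: submx_trans (submxMr P h) _; rewrite -hP; apply: windows_subS; lia.
Qed.

Lemma first_dep_le s s' t : (s <= s')%N -> first_dep s' t -> first_dep s t.
Proof. by move=> /subnK <-; elim: (s' - s)%N => [|n IH] //= /first_depS. Qed.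

Lemma wrank_cons s v t : (s <= size t + 1)%N ->
  wrank s (v :: t) = (wrank s t + ~~ first_dep s (v :: t))%N.
Proof.
move=> hs; rewrite /wrank /first_dep /= -(addn1 (size t)) hs /=.
have -> : (size t + 1 + 1 - s = 1 + (size t + 1 - s))%N by lia.
by rewrite windowsS mxrank_col_row.
Qed.

Lemma first_dep0 t : first_dep 0 t.
Proof. by rewrite /first_dep /=; apply/submxP; exists 0; apply/matrixP => i []. Qed.

Lemma card_first_dep s t : (s <= size t)%N ->
  #|[set v : V3 | first_dep s.+1 (v :: t)]| =
  (if first_dep s t then 2 ^ (wrank s.+1 t - wrank s t) else 0)%N.
Proof.
move=> hs; have hd v : first_dep s.+1 (v :: t) =
   (row_mx v (windows t 1 s) <= windows t (size t - s) s.+1)%MS.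
  rewrite /first_dep /= ltnS hs /= subSS.
  congr (row_mx _ _ <= _)%MS; apply/row_matrixP => i; rewrite rowK (ord1 i).
  by apply/rowP => x; rewrite !mxE.
rewrite (eq_card (B := [set v | row_mx v (windows t 1 s) <= windows t (size t - s) s.+1]%MS)); last first.
  by move=> v; rewrite !inE hd.
rewrite card_row_completions card_Fp //.
have -> : first_dep s t = (windows t 1 s <= windows (behead t) (size t - s) s)%MS.
  by rewrite /first_dep hs.
case: ifP => // h; congr (_ ^ (_ - _))%N; rewrite /wrank.
  by have -> : (size t + 1 - s.+1 = size t - s)%N by lia.
(* The first window is dependent, so removing it leaves the rank [wrank s t] unchanged. *)
have -> : (size t + 1 - s = 1 + (size t - s))%N by lia.
by rewrite windowsS mxrank_col_row h addn0.
Qed.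

Local Open Scope nat_scope.

(** * The chain of splitting types *)

(* A splitting type e1 >= e2 >= e3 >= e4 is stored by its gaps
   (a, b, c, d) = (e1 - e2, e2 - e3, e3 - e4, e4), and [part a b c d q] is the
   part of 0-based index [q]. *)
Definition part a b c d q :=
  match q with 0 => a + b + c + d | 1 => b + c + d | 2 => c + d | _ => d end.

Definition trunc_sum s a b c d :=
  minn (a + b + c + d) s + minn (b + c + d) s + minn (c + d) s + minn d s.

Definition raise a b c d q :=
  match q with
  | 0 => (a.+1, b, c, d) | 1 => (a.-1, b.+1, c, d)
  | 2 => (a, b.-1, c.+1, d) | _ => (a, b, c.-1, d.+1)
  end.

(** Four lengths suffice as tests: the largest dependent length of the new sequence is always a part
    of the old type, and that part is raised. *)
Definition next_mark a b c d t :=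
  if first_dep (a + b + c + d) t then 0
  else if first_dep (b + c + d) t then 1
  else if first_dep (c + d) t then 2 else 3.

(* The last component is the mark: the index of the part raised last, which is
   the last index of its group of equal parts. *)
Fixpoint profile (t : seq V3) : nat * nat * nat * nat * nat :=
  if t is v :: t' then
    let: (a, b, c, d, _) := profile t' in
    let q := next_mark a b c d t in (raise a b c d q, q)
  else (1, 0, 0, 0, 0).

Definition mark_ok a b c d q :=
  match q with 0 => 0 < a | 1 => 0 < b | 2 => 0 < c | 3 => 0 < d | _ => false end.

(** The third clause is the content of the mark: the dependent lengths are those below the part
    raised last. *)
Definition describes t a b c d q :=
  [/\ a + 2 * b + 3 * c + 4 * d = (size t).+1,
      forall s, s <= (size t).+1 -> wrank s t + s = trunc_sum s a b c d,
      forall s, first_dep s t = (s < part a b c d q)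
    & mark_ok a b c d q].

Definition above s a b c d :=
  (s <= a + b + c + d) + (s <= b + c + d) + (s <= c + d) + (s <= d).

Lemma trunc_sumS s a b c d :
  trunc_sum s.+1 a b c d = trunc_sum s a b c d + above s.+1 a b c d.
Proof.
have m e : minn e s.+1 = minn e s + (s < e) by lia.
by rewrite /trunc_sum !m /above; lia.
Qed.

(** The value of [card_first_dep] under the rank formula: passing from length s - 1 to s raises the
    rank by the number of parts that are at least s, minus 1. Length 0 admits all 8 vectors. *)
Definition dep_count s a b c d q :=
  if s == 0 then 8
  else if s <= part a b c d q then 2 ^ (above s a b c d).-1
  else 0.

Lemma card_V3 : #|{: V3}| = 8.
Proof. by rewrite card_mx card_Fp. Qed.

Section Step.
Variables (t : seq V3) (a b c d q : nat).
Hypothesis D : describes t a b c d q.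

Lemma card_dep s : s <= (size t).+1 ->
  #|[set v : V3 | first_dep s (v :: t)]| = dep_count s a b c d q.
Proof.
case: D => hn hr hf hq; rewrite /dep_count; case: s => [|s] hs /=.
  by rewrite -card_V3; apply: eq_card => v; rewrite inE first_dep0.
rewrite card_first_dep // hf; case: ifP => // _; congr (_ ^ _).
by have := hr _ hs; rewrite trunc_sumS; have := hr s (ltnW hs); lia.
Qed.

Lemma dep_nested s s' : s <= s' ->
  [set v : V3 | first_dep s' (v :: t)] \subset [set v : V3 | first_dep s (v :: t)].
Proof. by move=> h; apply/subsetP => v; rewrite !inE; apply: first_dep_le. Qed.

(** Nested sets of equal size coincide. Since [dep_count] is constant between consecutive parts as
    long as it is nonzero, the largest dependent length cannot fall strictly between two parts. *)
Lemma dep_stable v s s' : s <= s' -> s' <= (size t).+1 ->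
  dep_count s a b c d q = dep_count s' a b c d q ->
  first_dep s (v :: t) -> first_dep s' (v :: t).
Proof.
move=> h hs' e f.
have : v \in [set v : V3 | first_dep s (v :: t)] by rewrite inE.
have /eqP <- : [set v : V3 | first_dep s' (v :: t)] == [set v : V3 | first_dep s (v :: t)].
  by rewrite eqEcard dep_nested //= !card_dep ?e // (leq_trans h).
by rewrite inE.
Qed.

(** All four parts reach length [d], so for positive [d] the count is 2^3 = 8, that is, every
    vector. *)
Lemma dep_last v : first_dep d (v :: t).
Proof.
have hs : d <= (size t).+1 by case: D => hn _ _ _; lia.
have : v \in [set v : V3 | first_dep d (v :: t)].
  have /eqP -> : [set v : V3 | first_dep d (v :: t)] == [set: V3]; last by rewrite inE.
  rewrite eqEcard subsetT card_dep // cardsT card_V3.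
  case: D => hn _ _ hq; rewrite /dep_count; case: (d) => [|d'] //=.
  have -> : d'.+1 <= part a b c d'.+1 q by case: (q) => [|[|[|q']]] /=; lia.
  have -> : above d'.+1 a b c d'.+1 = 4 by rewrite /above; lia.
  by [].
by rewrite inE.
Qed.

Lemma dep_count_eq s s' : 0 < s -> 0 < s' ->
  s <= part a b c d q -> s' <= part a b c d q ->
  above s a b c d = above s' a b c d -> dep_count s a b c d q = dep_count s' a b c d q.
Proof. by rewrite /dep_count; case: s s' => [|s] [|s'] // _ _ -> -> ->. Qed.

Lemma dep_count_eq0 s : part a b c d q < s -> dep_count s a b c d q = 0.
Proof. by rewrite /dep_count; case: s => //= s; rewrite ltnNge => /negbTE ->. Qed.

Lemma dep_none v s : s <= (size t).+1 -> part a b c d q < s -> ~~ first_dep s (v :: t).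
Proof.
move=> hs h; have := card_dep hs; rewrite dep_count_eq0 // => /eqP.
by rewrite cards_eq0 => /eqP /setP /(_ v); rewrite !inE => ->.
Qed.

(** By [wrank_cons], prepending adds 1 to the rank exactly for lengths above the selected part e,
    and this is min(e + 1, s) - min(e, s). A test that fails just before the next one succeeds
    forces a positive gap, so the raised type stays sorted. *)
Lemma next_describes v (q' := next_mark a b c d (v :: t)) :
  let: (a', b', c', d') := raise a b c d q' in
  (q' <= 3) /\ describes (v :: t) a' b' c' d' q'.
Proof.
have hd s : first_dep s (v :: t) = (s <= part a b c d q') /\
     (mark_ok (raise a b c d q').1.1.1 (raise a b c d q').1.1.2 (raise a b c d q').1.2 (raise a b c d q').2 q') /\
     match q' with 0 => true | 1 => 0 < a | 2 => 0 < b | 3 => 0 < c | _ => false end.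
  case: D => hn _ _ hq.
  have far : (size t).+1 < s -> ~~ first_dep s (v :: t) by rewrite /first_dep /=; lia.
  have none := @dep_none v s.
  rewrite /q' /next_mark.
  case: ifPn => [f1|f1] /=; [|case: ifPn => [f2|f2] /=; [|case: ifPn => [f3|f3] /=]].
  - split=> //; case: leqP => hs; first by apply: first_dep_le hs f1.
    apply/negbTE; case: (leqP s (size t).+1) => // h; apply: none => //.
    by case: (q) => [|[|[|q'']]] /=; lia.
  - have a0 : 0 < a by case: (posnP a) f1 => // ->; rewrite f2.
    split=> //; case: leqP => hs; first by apply: first_dep_le hs f2.
    apply/negbTE; case: (leqP s (size t).+1) => // h.
    case: (ltnP (part a b c d q) s) => hqs; first exact: none.
    case: (leqP (a + b + c + d) s) => h1; first by apply: contra f1; apply: first_dep_le.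
    apply: contra f1; apply: dep_stable => //; [lia|lia|].
    have q0 : a + b + c + d <= part a b c d q by move: hqs; case: (q) => [|[|[|q'']]] /=; lia.
    by apply: dep_count_eq => //; [lia | lia | rewrite /above; lia].
  - have b0 : 0 < b by case: (posnP b) f2 => // ->; rewrite f3.
    split=> //; case: leqP => hs; first by apply: first_dep_le hs f3.
    apply/negbTE; case: (leqP s (size t).+1) => // h.
    case: (ltnP (part a b c d q) s) => hqs; first exact: none.
    case: (leqP (b + c + d) s) => h1; first by apply: contra f2; apply: first_dep_le.
    apply: contra f2; apply: dep_stable => //; [lia|lia|].
    have q0 : b + c + d <= part a b c d q by move: hqs; case: (q) => [|[|[|q'']]] /=; lia.
    by apply: dep_count_eq => //; [lia | lia | rewrite /above; lia].
  - have f4 := dep_last v.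
    have c0 : 0 < c by case: (posnP c) f3 => // ->; rewrite f4.
    split=> //; case: leqP => hs; first by apply: first_dep_le hs f4.
    apply/negbTE; case: (leqP s (size t).+1) => // h.
    case: (ltnP (part a b c d q) s) => hqs; first exact: none.
    case: (leqP (c + d) s) => h1; first by apply: contra f3; apply: first_dep_le.
    apply: contra f3; apply: dep_stable => //; [lia|lia|].
    have q0 : c + d <= part a b c d q by move: hqs; case: (q) => [|[|[|q'']]] /=; lia.
    by apply: dep_count_eq => //; [lia | lia | rewrite /above; lia].
have hd1 s := proj1 (hd s); have [hd2 hd3] := proj2 (hd 0).
case: D => hn hr _ _.
have wr s : s <= (size t).+1 -> wrank s (v :: t) + s = trunc_sum s a b c d + ~~ (s <= part a b c d q').
  by move=> hs; rewrite wrank_cons ?hd1 ?addn1 //; have := hr _ hs; lia.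
(* This length is out of reach of [wr]. No window has it, and [trunc_sum] is then the sum of all
   parts, namely the length itself. *)
have wr2 : wrank (size t).+2 (v :: t) = 0.
  apply/eqP; rewrite -leqn0; apply: leq_trans (rank_leq_row _) _; rewrite /=; lia.
move: hd1 hd2 hd3 wr; clear hd; clearbody q'.
case: q' => [|[|[|[|//]]]] /= hd1 hd2 hd3 wr; (split; first by []); split=> //=; try lia.
all: try by move=> s; rewrite hd1; lia.
all: move=> s; rewrite leq_eqVlt => /orP [/eqP -> | hs]; first by rewrite wr2 /trunc_sum; lia.
all: rewrite wr // /trunc_sum; lia.
Qed.

End Step.

Lemma profile_describes t :
  let: (a, b, c, d, q) := profile t in describes t a b c d q.
Proof.
elim: t => [|v t] /=.
  split=> //= s.
    case: s => [|[|//]] _.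
      have -> : wrank 0 [::] = 0 by apply/eqP; rewrite -leqn0; exact: rank_leq_col.
      by [].
    have -> : wrank 1 [::] = 0 by apply/eqP; rewrite -leqn0; exact: rank_leq_row.
    by [].
  by case: s => [|s]; first exact: first_dep0.
case: (profile t) => [[[[a b] c] d] q] D.
have := next_describes D v.
by rewrite /=; case: (raise _ _ _ _ _) => [[[a' b'] c'] d'] [].
Qed.

Definition lower a b c d q :=
  match q with
  | 0 => (a.-1, b, c, d) | 1 => (a.+1, b.-1, c, d)
  | 2 => (a, b.+1, c.-1, d) | _ => (a, b, c.+1, d.-1)
  end.

Definition jump_count a b c d q j :=
  match j with
  | 0 => dep_count (part a b c d 0) a b c d q
  | j'.+1 => dep_count (part a b c d j) a b c d q - dep_count (part a b c d j') a b c d q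
  end.

Lemma card_next_mark t a b c d q j : describes t a b c d q -> j <= 3 ->
  #|[set v | next_mark a b c d (v :: t) == j]| = jump_count a b c d q j.
Proof.
move=> D hj; have [hn _ _ hq] := D.
have cd i : #|[set v : V3 | first_dep (part a b c d i) (v :: t)]| = dep_count (part a b c d i) a b c d q.
  by apply: card_dep => //; case: i => [|[|[|i]]] /=; lia.
have diff i : i <= 2 -> #|[set v : V3 | first_dep (part a b c d i.+1) (v :: t) && ~~ first_dep (part a b c d i) (v :: t)]| = jump_count a b c d q i.+1.
  move=> hi; rewrite /jump_count -!cd.
  have /setIidPr ss : [set v : V3 | first_dep (part a b c d i) (v :: t)] \subset [set v : V3 | first_dep (part a b c d i.+1) (v :: t)].
    by apply: dep_nested; case: i hi => [|[|[|i]]] //=; lia.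
  rewrite -ss -cardsD; apply: eq_card => v.
  by rewrite !inE andbC.
case: j hj => [|[|[|[|//]]]] _.
- rewrite -[RHS]cd; apply: eq_card => v; rewrite !inE /next_mark /=.
  by do 3?[case: (first_dep _ _)].
- rewrite -diff //; apply: eq_card => v; rewrite !inE /next_mark /=.
  by do 3?[case: (first_dep _ _)].
- rewrite -diff //; apply: eq_card => v; rewrite !inE /next_mark /=.
  have := @first_dep_le (b + c + d) (a + b + c + d) (v :: t) ltac:(lia).
  by do 3?[case: (first_dep _ _)] => // /(_ isT).
- rewrite -diff //; apply: eq_card => v; rewrite !inE /next_mark /= (dep_last D v) /=.
  have := @first_dep_le (c + d) (b + c + d) (v :: t) ltac:(lia).
  have := @first_dep_le (c + d) (a + b + c + d) (v :: t) ltac:(lia).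
  case: (first_dep (c + d) _) => /=; first by do 2?[case: (first_dep _ _)].
  by do 2?[case: (first_dep _ _)] => // h1 h2; [have := h1 isT | have := h1 isT | have := h2 isT].
Qed.

(** [lower] undoes [raise] when the marked gap is positive, so the new type and mark determine the
    old type. *)
Lemma card_profile_cons t a b c d q a' b' c' d' q' :
  profile t = (a, b, c, d, q) ->
  #|[set v | profile (v :: t) == (a', b', c', d', q')]| =
  (mark_ok a' b' c' d' q' && ((a, b, c, d) == lower a' b' c' d' q')) * jump_count a b c d q q'.
Proof.
move=> e; have := profile_describes t; rewrite e => D.
have key v : (profile (v :: t) == (a', b', c', d', q')) =
   (mark_ok a' b' c' d' q' && ((a, b, c, d) == lower a' b' c' d' q')) && (next_mark a b c d (v :: t) == q').
  rewrite [profile _]/= e.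
  have := next_describes D v; rewrite /=; set q0 := next_mark _ _ _ _ _.
  case: (eqVneq q0 q') => [-> | hne]; last first.
    rewrite andbF; case: (raise _ _ _ _ _) => [[[? ?] ?] ?] _.
    by apply/eqP => [[_ _ _ _ h]]; move: hne; rewrite h eqxx.
  case: q' => [|[|[|[|q']]]] /=.
  all: try by have [hn _ _ _] := D; case=> _ [/= hn' _ _ h]; rewrite !xpair_eqE ?eqxx ?andbT; lia.
have [hq' | hq'] := leqP q' 3; last first.
  have -> : mark_ok a' b' c' d' q' = false by case: q' hq' {key} => [|[|[|[|]]]].
  rewrite mul0n; apply/eqP; rewrite cards_eq0; apply/eqP/setP => v; rewrite !inE key.
  by case: q' hq' {key} => [|[|[|[|]]]].
rewrite -(card_next_mark D hq').
case hb : (_ && _); rewrite ?mul1n ?mul0n; last first.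
  by apply/eqP; rewrite cards_eq0; apply/eqP/setP => v; rewrite !inE key hb.
by apply: eq_card => v; rewrite !inE key hb.
Qed.

(** * Number of sequences with a given profile *)

Fixpoint sequences (N : nat) : seq (seq V3) :=
  if N is N'.+1 then [seq v :: t | t <- sequences N', v <- enum {: V3}] else [:: [::]].

Definition profile_count N X := \sum_(t <- sequences N) (profile t == X).

Lemma size_sequences N t : t \in sequences N -> size t = N.
Proof.
elim: N t => [|N IH] t /=; first by rewrite inE => /eqP ->.
by case/allpairsP => [[u v]] [/= hu _ ->] /=; rewrite IH.
Qed.

Lemma sum_enum_card (I : finType) (P : pred I) : \sum_(v <- enum I) P v = #|[set v | P v]|.
Proof. by rewrite big_enum /= -sum1dep_card [RHS]big_mkcond; apply: eq_bigr => v _; case: (P v). Qed.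

Arguments profile : simpl never.

(** Transition equation of the chain: the old type is forced, only its mark remains to be summed
    over. *)
Lemma profile_countS N a b c d j :
  profile_count N.+1 (a, b, c, d, j) =
  mark_ok a b c d j *
  let: (a', b', c', d') := lower a b c d j in
  \sum_(q < 4) profile_count N (a', b', c', d', q : nat) * jump_count a' b' c' d' q j.
Proof.
rewrite /profile_count /= big_allpairs_dep /=.
under eq_bigr => t _ do rewrite sum_enum_card.
case E : (lower a b c d j) => [[[a' b'] c'] d'].
under [in RHS]eq_bigr => q _ do rewrite big_distrl /=.
rewrite exchange_big big_distrr /=; apply: eq_bigr => t _.
have := profile_describes t.
case Ep : (profile t) => [[[[a0 b0] c0] d0] q0] [_ _ _ hq0].
rewrite (card_profile_cons _ _ _ _ _ Ep) E.
have q4 : q0 < 4 by case: q0 hq0 {Ep} => [|[|[|[|q0]]]].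
rewrite (bigD1 (Ordinal q4)) //= big1 ?addn0; last first.
  move=> q hq; rewrite !xpair_eqE; have -> : (q0 == q) = false; last by rewrite andbF.
  by apply: contraNF hq => /eqP e; apply/eqP/val_inj.
rewrite [in RHS]xpair_eqE (eqxx q0) andbT; case: (mark_ok _ _ _ _ _); rewrite /= ?mul0n ?mul1n //.
by case: eqP => [[-> -> -> ->]|].
Qed.

(* The counts depend on the gaps only through the booleans
   A = (0 < a), B = (0 < b), C = (0 < c), D = (0 < d). *)
Definition dep_pat (A B C D : bool) q j : nat :=
  let zero := match j with
    | 0 => ~~ [|| A, B, C | D] | 1 => ~~ [|| B, C | D] | 2 => ~~ (C || D) | _ => ~~ D end in
  let le := match j, q with
    | 0, 1 => ~~ A | 0, 2 => ~~ (A || B) | 0, 3 => ~~ [|| A, B | C]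
    | 1, 2 => ~~ B | 1, 3 => ~~ (B || C) | 2, 3 => ~~ C | _, _ => true end in
  let upto := match j with
    | 0 => if A then 0 else if B then 1 else if C then 2 else 3
    | 1 => if B then 1 else if C then 2 else 3
    | 2 => if C then 2 else 3 | _ => 3 end in
  if zero then 8 else if le then 2 ^ upto else 0.

Definition jump_pat A B C D q j : nat :=
  if j is j'.+1 then dep_pat A B C D q j - dep_pat A B C D q j' else dep_pat A B C D q 0.

Lemma dep_countE a b c d q j : q <= 3 -> j <= 3 ->
  dep_count (part a b c d j) a b c d q = dep_pat (0 < a) (0 < b) (0 < c) (0 < d) q j.
Proof.
move=> hq hj; rewrite /dep_count /dep_pat.
have -> : (part a b c d j == 0) = match j with
    | 0 => ~~ [|| 0 < a, 0 < b, 0 < c | 0 < d] | 1 => ~~ [|| 0 < b, 0 < c | 0 < d]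
    | 2 => ~~ ((0 < c) || (0 < d)) | _ => ~~ (0 < d) end.
  by case: j hj => [|[|[|[|]]]] //= _; lia.
have -> : (part a b c d j <= part a b c d q) = match j, q with
    | 0, 1 => ~~ (0 < a) | 0, 2 => ~~ ((0 < a) || (0 < b)) | 0, 3 => ~~ [|| 0 < a, 0 < b | 0 < c]
    | 1, 2 => ~~ (0 < b) | 1, 3 => ~~ ((0 < b) || (0 < c)) | 2, 3 => ~~ (0 < c) | _, _ => true end.
  by case: j hj => [|[|[|[|]]]] //= _; case: q hq => [|[|[|[|]]]] //= _; lia.
do 2!case: ifP => // _; congr (_ ^ _); rewrite /above.
by case: j hj => [|[|[|[|]]]] //= _; case: (posnP a); case: (posnP b); case: (posnP c) => *; subst; rewrite ?ltnn; lia.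
Qed.

Lemma jump_countE a b c d q j : q <= 3 -> j <= 3 ->
  jump_count a b c d q j = jump_pat (0 < a) (0 < b) (0 < c) (0 < d) q j.
Proof.
move=> hq hj; rewrite /jump_count /jump_pat; case: j hj => [|j] hj; first by rewrite dep_countE.
by rewrite !dep_countE // ltnW.
Qed.

(** * Explicit solution of the chain *)

Local Open Scope ring_scope.

(* The number of sequences with bundle E is #(everywhere independent triples of
   sections) / #|Aut E|.  The density of such triples gives [zero_weight] (it
   depends on the number of zero parts), the factors GL_n(F_2) of Aut E for n
   equal parts give [mult_weight], and the triangular part of Aut E the power of
   2 in [weight].  Given the type, the marked group is the first step of the
   filtration of the fibre of E at infinity not contained in a uniformly
   distributed hyperplane; [mark_weight] counts these hyperplanes. *)
Definition zero_weight (B C D : bool) : rat :=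
  if D then 441 / 512 else if C then 63 / 64 else if B then 21 / 16 else 21 / 8.

Definition mult_weight (A B C : bool) : rat :=
  match A, B, C with
  | false, false, false => 315 | true, false, false => 21 | false, false, true => 21
  | false, true, false => 9 | true, true, true => 1 | _, _, _ => 3 end.

Definition mark_weight (A B C : bool) q : rat :=
  match q with
  | 0 => 16 - 8 | 1 => (if A then 8 else 16) - 4
  | 2 => (if B then 4 else if A then 8 else 16) - 2
  | _ => (if C then 2 else if B then 4 else if A then 8 else 16) - 1 end.

Definition pat_ok (A B C D : bool) q :=
  match q with 0 => A | 1 => B | 2 => C | 3 => D | _ => false end.

Definition pat_weight A B C D q : rat :=
  if pat_ok A B C D q then zero_weight B C D * mark_weight A B C q / mult_weight A B C else 0.

Ltac natcomp := repeat match goal with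
 |- context [ jump_pat ?A ?B ?C ?D ?q ?j ] =>
    let n := eval vm_compute in (jump_pat A B C D q j) in
    change (jump_pat A B C D q j) with n
 end.

Definition pat_step A B C D j : rat :=
  pat_weight A B C D 0 * (jump_pat A B C D 0 j)%:R + pat_weight A B C D 1 * (jump_pat A B C D 1 j)%:R +
  pat_weight A B C D 2 * (jump_pat A B C D 2 j)%:R + pat_weight A B C D 3 * (jump_pat A B C D 3 j)%:R.

Ltac pat_solve := rewrite /pat_step; natcomp;
 rewrite /pat_weight /zero_weight /mark_weight /mult_weight; cbn [pat_ok]; lra.

(** These four lemmas are the transition equations on patterns, one for each raised part. The
    factors 1, 4, 16, 64 arise because raising part [j] adds 2j to the exponent of 2 in [weight].
    The hypothesis here excludes the zero type as a predecessor. *)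
Lemma pat_step0 A B C D : [|| A, B, C | D] -> pat_weight true B C D 0 = pat_step A B C D 0.
Proof. by case: A B C D => [] [] [] [] h; [pat_solve..|]. Qed.
Lemma pat_step1 A B C D : 4 * pat_weight A true C D 1 = pat_step true B C D 1.
Proof. case: A B C D => [] [] [] []; pat_solve. Qed.
Lemma pat_step2 A B C D : 16 * pat_weight A B true D 2 = pat_step A true C D 2.
Proof. case: A B C D => [] [] [] []; pat_solve. Qed.
Lemma pat_step3 A B C D : 64 * pat_weight A B C true 3 = pat_step A B true D 3.
Proof. case: A B C D => [] [] [] []; pat_solve. Qed.

(** With parts e1 to e4, the exponent is 3 (e1 + e2 + e3 + e4) minus the sum of the differences e_i
    - e_j over i < j: triples of sections against the triangular part of Aut E, constants aside. *)
Definition weight a b c d q : rat :=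
  2 ^+ (2 * b + 6 * c + 12 * d) * pat_weight (0 < a)%N (0 < b)%N (0 < c)%N (0 < d)%N q.

Lemma weight_step a b c d j : mark_ok a b c d j -> (1 < a + 2 * b + 3 * c + 4 * d)%N ->
  weight a b c d j = let: (a', b', c', d') := lower a b c d j in
    \sum_(q < 4) weight a' b' c' d' q * (jump_count a' b' c' d' q j)%:R.
Proof.
have J x y z w i : (i <= 3)%N ->
    \sum_(q < 4) weight x y z w q * (jump_count x y z w q i)%:R =
    2 ^+ (2 * y + 6 * z + 12 * w) * pat_step (0 < x)%N (0 < y)%N (0 < z)%N (0 < w)%N i.
  move=> hi; rewrite !big_ord_recl big_ord0 addr0 /pat_step /weight !jump_countE //.
  by rewrite !addrA !mulrDr !mulrA.
case: j => [|[|[|[|//]]]] hm h1; rewrite /lower J // /weight.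
- by case: a hm h1 => // a _ h1; rewrite -pat_step0 //; lia.
- have [b' ->] : exists b', b = b'.+1 by exists b.-1; rewrite prednK.
  have -> : (2 * b'.+1 + 6 * c + 12 * d = 2 + (2 * b' + 6 * c + 12 * d))%N by lia.
  rewrite [b'.+1.-1]/= -(pat_step1 (0 < a)%N) ltn0Sn exprD.
  by move: (2 ^+ (2 * b' + 6 * c + 12 * d)) (pat_weight _ _ _ _ _) => x y; ring.
- have [c' ->] : exists c', c = c'.+1 by exists c.-1; rewrite prednK.
  have -> : (2 * b + 6 * c'.+1 + 12 * d = 4 + (2 * b.+1 + 6 * c' + 12 * d))%N by lia.
  rewrite [c'.+1.-1]/= -(pat_step2 _ (0 < b)%N) !ltn0Sn exprD.
  by move: (2 ^+ (2 * b.+1 + 6 * c' + 12 * d)) (pat_weight _ _ _ _ _) => x y; ring.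
- have [d' ->] : exists d', d = d'.+1 by exists d.-1; rewrite prednK.
  have -> : (2 * b + 6 * c + 12 * d'.+1 = 6 + (2 * b + 6 * c.+1 + 12 * d'))%N by lia.
  rewrite [d'.+1.-1]/= -(pat_step3 _ _ (0 < c)%N) !ltn0Sn exprD.
  by move: (2 ^+ (2 * b + 6 * c.+1 + 12 * d')) (pat_weight _ _ _ _ _) => x y; ring.
Qed.

Lemma weight0 a b c d q : ~~ mark_ok a b c d q -> weight a b c d q = 0.
Proof.
by rewrite /weight /pat_weight => h; case: ifP; rewrite ?mulr0 // => h'; case: q h h' => [|[|[|[|]]]] //= /negbTE ->.
Qed.

(** Both sides obey the same recursion ([profile_countS], [weight_step]), and the constants are
    normalized so that the profile of the empty sequence has weight 1. *)
Lemma profile_countE N a b c d q :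
  (profile_count N (a, b, c, d, q))%:R =
  if (a + 2 * b + 3 * c + 4 * d == N.+1)%N then weight a b c d q else 0 :> rat.
Proof.
elim: N a b c d q => [|N IH] a b c d q.
  rewrite /profile_count big_seq1 /=.
  case: (boolP (mark_ok a b c d q)) => hm; last first.
    rewrite weight0 // if_same; case: eqP => // [[? ? ? ? ?]]; subst; by [].
  case: eqP => [[<- <- <- <- <-]|hne] /=.
    by rewrite /weight /pat_weight /zero_weight /mark_weight /mult_weight /=; lra.
  case: eqP => // h; case: hne.
  have [? ? ? ?] : [/\ a = 1, b = 0, c = 0 & d = 0]%N by split; lia.
  by subst; case: q hm => [|[|[|[|]]]].
rewrite profile_countS; case: (boolP (mark_ok a b c d q)) => hm; last first.
  by rewrite mul0n weight0 // if_same.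
rewrite mul1n.
have hs : let: (a', b', c', d') := lower a b c d q in
     ((a' + 2 * b' + 3 * c' + 4 * d') = (a + 2 * b + 3 * c + 4 * d).-1)%N.
  by case: q hm => [|[|[|[|]]]] //=; lia.
case: eqP => e.
  rewrite weight_step ?e //.
  case: (lower a b c d q) hs => [[[a' b'] c'] d'] hs; rewrite natr_sum.
  by apply: eq_bigr => i _; rewrite natrM IH hs e eqxx.
case: (lower a b c d q) hs => [[[a' b'] c'] d'] hs; rewrite natr_sum big1 // => i _.
by rewrite natrM IH hs; case: eqP => [h|_]; [lia | rewrite mul0r].
Qed.

(** * Reduction of the height *)

Definition on_profile (Phi : nat -> nat -> nat -> nat -> rat) t :=
  let: (a, b, c, d, _) := profile t in Phi a b c d.

Definition profile_sum N Phi : rat := \sum_(t <- sequences N) on_profile Phi t.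

Definition pat_total A B C D := pat_weight A B C D 0 + pat_weight A B C D 1 +
  pat_weight A B C D 2 + pat_weight A B C D 3.

Definition type_weight a b c d : rat :=
  2 ^+ (2 * b + 6 * c + 12 * d) * pat_total (0 < a)%N (0 < b)%N (0 < c)%N (0 < d)%N.

Lemma sum_ord_eq n x (F : nat -> rat) : (x < n)%N -> \sum_(i < n) (x == i)%:R * F i = F x.
Proof.
move=> h; rewrite (bigD1 (Ordinal h)) //= eqxx mul1r big1 ?addr0 // => i hi.
have -> : (x == i) = false; last by rewrite mul0r.
by apply: contraNF hi => /eqP e; apply/eqP/val_inj.
Qed.

(** The four bounds are independent so that an index about to be shifted can have range one
    longer. *)
Lemma profile_sumE N Phi nA nB nC nD : (N.+1 < nA)%N -> (N.+1 < nB)%N -> (N.+1 < nC)%N -> (N.+1 < nD)%N ->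
  profile_sum N Phi = \sum_(a < nA) \sum_(b < nB) \sum_(c < nC) \sum_(d < nD)
   (if (a + 2 * b + 3 * c + 4 * d == N.+1)%N then type_weight a b c d * Phi a b c d else 0).
Proof.
move=> hA hB hC hD.
transitivity (\sum_(t <- sequences N) \sum_(a < nA) \sum_(b < nB) \sum_(c < nC) \sum_(d < nD)
    \sum_(q < 4) (profile t == (a : nat, b : nat, c : nat, d : nat, q : nat))%:R * Phi a b c d).
  rewrite /profile_sum !big_seq; apply: eq_bigr => t /size_sequences ht.
  rewrite /on_profile; have := profile_describes t.
  case: (profile t) => [[[[a b] c] d] q] [hn _ _ hq]; rewrite ht in hn.
  have hq4 : (q < 4)%N by case: q hq => [|[|[|[|]]]].
  (* The indicator of a tuple factors, so the sums can be collapsed one index at a time. *)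
  have E (a' b' c' d' q' : nat) : ((a, b, c, d, q) == (a', b', c', d', q'))%:R =
    (a == a')%:R * ((b == b')%:R * ((c == c')%:R * ((d == d')%:R * (q == q')%:R))) :> rat.
    by rewrite !xpair_eqE -!mulnb !natrM -!mulrA.
  under eq_bigr => a' _. under eq_bigr => b' _. under eq_bigr => c' _. under eq_bigr => d' _.
    under eq_bigr => q' _ do rewrite E -!mulrA.
    rewrite -big_distrr /= -big_distrr /= -big_distrr /= -big_distrr /=.
    rewrite (@sum_ord_eq 4 q (fun=> Phi a' b' c' d')) //. over.
    rewrite -big_distrr /= -big_distrr /= -big_distrr /= (@sum_ord_eq nD d (fun d' => Phi a' b' c' d')) //; last lia. over.
    rewrite -big_distrr /= -big_distrr /= (@sum_ord_eq nC c (fun c' => Phi a' b' c' d)) //; last lia. over.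
    rewrite -big_distrr /= (@sum_ord_eq nB b (fun b' => Phi a' b' c d)) //; last lia. over.
  by rewrite (@sum_ord_eq nA a (fun a' => Phi a' b c d)) //; lia.
rewrite exchange_big; apply: eq_bigr => a _; rewrite exchange_big; apply: eq_bigr => b _.
rewrite exchange_big; apply: eq_bigr => c _; rewrite exchange_big; apply: eq_bigr => d _.
rewrite exchange_big /=.
have E (q : nat) : \sum_(t <- sequences N) (profile t == (a : nat, b : nat, c : nat, d : nat, q))%:R * Phi a b c d =
   (if (a + 2 * b + 3 * c + 4 * d == N.+1)%N then weight a b c d q else 0) * Phi a b c d.
  by rewrite -big_distrl /= -natr_sum -profile_countE.
under eq_bigr => q _ do rewrite E.
case: eqP => _; last by rewrite big1 // => q _; rewrite mul0r.
rewrite -big_distrl /=; congr (_ * _).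
by rewrite !big_ord_recl big_ord0 addr0 /type_weight /pat_total /weight !mulrDr !addrA.
Qed.

Ltac tot_solve := rewrite /pat_total /pat_weight /zero_weight /mark_weight /mult_weight; cbn [pat_ok]; lra.

(** The ratio does not involve [A], and it depends on the type only through its number of zero
    parts; this makes a recursion between strata possible. *)
Lemma pat_total3 A B C D : [|| A, B, C | D] ->
  pat_total A B C true = (if D then 1 else if C then 15 / 16 else if B then 105 / 128 else 315 / 512) * pat_total A B C D.
Proof. by case: A B C D => [] [] [] [] h; [tot_solve..|]. Qed.

Lemma pat_total2 A B C : [|| A, B | C] ->
  pat_total A B true false = (if C then 1 else if B then 21 / 8 else 147 / 32) * pat_total A B C false.
Proof. by case: A B C => [] [] [] h; [tot_solve..|]. Qed.

Lemma pat_total1 A B : A || B ->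
  pat_total A true false false = (if B then 1 else 21 / 4) * pat_total A B false false.
Proof. by case: A B => [] [] h; [tot_solve..|]. Qed.

(** The constants are 2^12 (1, 15/16, 15/16 7/8, 15/16 7/8 3/4), then 2^6 (1, 3 7/8, 7 7/8 3/4) and
    2^2 (1, 7 3/4). Here 3 is the number of planes of F_2^3 through a line, and 7 the number of its
    planes or of its lines. *)
Definition shift_coef3 b c d : rat := if (0 < d)%N then 4096 else if (0 < c)%N then 3840 else if (0 < b)%N then 3360 else 2520.
Definition shift_coef2 b c : rat := if (0 < c)%N then 64 else if (0 < b)%N then 168 else 294.
Definition shift_coef1 b : rat := if (0 < b)%N then 4 else 21.

Lemma type_weight3 a b c d : (0 < a + 2 * b + 3 * c + 4 * d)%N ->
  type_weight a b c d.+1 = shift_coef3 b c d * type_weight a b c d.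
Proof.
move=> h; rewrite /type_weight /shift_coef3.
have -> : (2 * b + 6 * c + 12 * d.+1 = 12 + (2 * b + 6 * c + 12 * d))%N by lia.
rewrite exprD ltn0Sn (@pat_total3 _ _ _ (0 < d)%N); last lia.
move: (2 ^+ (2 * b + 6 * c + 12 * d)) (pat_total _ _ _ _) => x y.
by case: (0 < d)%N; case: (0 < c)%N; case: (0 < b)%N; field.
Qed.

Lemma type_weight2 a b c : (0 < a + 2 * b + 3 * c)%N ->
  type_weight a b c.+1 0 = shift_coef2 b c * type_weight a b c 0.
Proof.
move=> h; rewrite /type_weight /shift_coef2.
have -> : (2 * b + 6 * c.+1 + 12 * 0 = 6 + (2 * b + 6 * c + 12 * 0))%N by lia.
rewrite exprD ltn0Sn ltnn (@pat_total2 _ _ (0 < c)%N); last lia.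
move: (2 ^+ (2 * b + 6 * c + 12 * 0)) (pat_total _ _ _ _) => x y.
by case: (0 < c)%N; case: (0 < b)%N; field.
Qed.

Lemma type_weight1 a b : (0 < a + 2 * b)%N ->
  type_weight a b.+1 0 0 = shift_coef1 b * type_weight a b 0 0.
Proof.
move=> h; rewrite /type_weight /shift_coef1.
have -> : (2 * b.+1 + 6 * 0 + 12 * 0 = 2 + (2 * b + 6 * 0 + 12 * 0))%N by lia.
rewrite exprD ltn0Sn ltnn (@pat_total1 _ (0 < b)%N); last lia.
move: (2 ^+ (2 * b + 6 * 0 + 12 * 0)) (pat_total _ _ _ _) => x y.
by case: (0 < b)%N; field.
Qed.

Lemma sum_ord_shift n (F G : nat -> rat) : F 0%N = 0 -> (forall i, F i.+1 = G i) ->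
  \sum_(i < n.+1) F i = \sum_(i < n) G i.
Proof. by move=> F0 FS; rewrite big_ord_recl F0 add0r; apply: eq_bigr => i _; rewrite lift0 FS. Qed.

Lemma sum_ord_head n (F : nat -> rat) : (forall i, F i.+1 = 0) -> \sum_(i < n.+1) F i = F 0%N.
Proof. by move=> FS; rewrite big_ord_recl big1 ?addr0 // => i _; rewrite lift0 FS. Qed.

(** In gap coordinates, subtracting 1 from all four parts changes [d] only and lowers the sum by 4.
    If exactly three or two parts are nonzero, the gap that changes is [c] or [b], and the sum falls
    by 3 or 2. *)
Lemma profile_sum3 N Phi :
  profile_sum (N + 4) (fun a b c d => if d is d'.+1 then Phi a b c d' else 0) =
  profile_sum N (fun a b c d => shift_coef3 b c d * Phi a b c d).
Proof.
pose n := (N + 6)%N.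
rewrite (@profile_sumE (N + 4) _ n n n n.+1) ?(@profile_sumE N _ n n n n) /n; try lia.
apply: eq_bigr => a _; apply: eq_bigr => b _; apply: eq_bigr => c _.
pose F d := if (a + 2 * b + 3 * c + 4 * d == (N + 4).+1)%N
  then type_weight a b c d * (if d is d'.+1 then Phi a b c d' else 0) else 0.
pose G d := if (a + 2 * b + 3 * c + 4 * d == N.+1)%N
  then type_weight a b c d * (shift_coef3 b c d * Phi a b c d) else 0.
apply: (@sum_ord_shift _ F G) => [|d]; rewrite /F /G; first by rewrite mulr0 if_same.
have -> : (a + 2 * b + 3 * c + 4 * d.+1 == (N + 4).+1)%N = (a + 2 * b + 3 * c + 4 * d == N.+1)%N by lia.
by case: eqP => // h; rewrite type_weight3; [ring | lia].
Qed.

Lemma profile_sum2 N Phi :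
  profile_sum (N + 3) (fun a b c d => if d is 0 then if c is c'.+1 then Phi a b c' else 0 else 0) =
  profile_sum N (fun a b c d => if d is 0 then shift_coef2 b c * Phi a b c else 0).
Proof.
pose n := (N + 6)%N.
rewrite (@profile_sumE (N + 3) _ n n n.+1 n.+1) ?(@profile_sumE N _ n n n n.+1) /n; try lia.
apply: eq_bigr => a _; apply: eq_bigr => b _.
pose G M (X : nat -> nat -> rat) c d := if (a + 2 * b + 3 * c + 4 * d == M)%N
  then type_weight a b c d * X c d else 0.
have red M Y c : \sum_(d < (N + 6).+1) G M (fun c d => if d is 0 then Y c else 0) c d = G M (fun c _ => Y c) c 0.
  by apply: (@sum_ord_head _ (G M (fun c d => if d is 0 then Y c else 0) c)) => d; rewrite /G mulr0 if_same.
under eq_bigr => c _ do rewrite (red (N + 3).+1 (fun c => if c is c'.+1 then Phi a b c' else 0)).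
under [RHS]eq_bigr => c _ do rewrite (red N.+1 (fun c => shift_coef2 b c * Phi a b c)).
apply: (@sum_ord_shift _ (fun c => G (N + 3).+1 (fun c _ => if c is c'.+1 then Phi a b c' else 0) c 0)
   (fun c => G N.+1 (fun c _ => shift_coef2 b c * Phi a b c) c 0)) => [|c]; rewrite /G; first by rewrite mulr0 if_same.
have -> : (a + 2 * b + 3 * c.+1 + 4 * 0 == (N + 3).+1)%N = (a + 2 * b + 3 * c + 4 * 0 == N.+1)%N by lia.
by case: eqP => // h; rewrite type_weight2; [ring | lia].
Qed.

Lemma profile_sum1 N Phi :
  profile_sum (N + 2) (fun a b c d => if (c + d)%N is 0 then if b is b'.+1 then Phi a b' else 0 else 0) =
  profile_sum N (fun a b c d => if (c + d)%N is 0 then shift_coef1 b * Phi a b else 0).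
Proof.
pose n := (N + 6)%N.
rewrite (@profile_sumE (N + 2) _ n n.+1 n.+1 n.+1) ?(@profile_sumE N _ n n n.+1 n.+1) /n; try lia.
apply: eq_bigr => a _.
pose G M (X : nat -> nat -> nat -> rat) b c d := if (a + 2 * b + 3 * c + 4 * d == M)%N
  then type_weight a b c d * X b c d else 0.
have red M Y b : \sum_(c < (N + 6).+1) \sum_(d < (N + 6).+1) G M (fun b c d => if (c + d)%N is 0 then Y b else 0) b c d = G M (fun b _ _ => Y b) b 0 0.
  rewrite (@sum_ord_head _ (fun c => \sum_(d < (N + 6).+1) G M (fun b c d => if (c + d)%N is 0 then Y b else 0) b c d)).
    by apply: (@sum_ord_head _ (G M (fun b c d => if (c + d)%N is 0 then Y b else 0) b 0)) => d; rewrite /G mulr0 if_same.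
  by move=> c; rewrite big1 // => d _; rewrite /G mulr0 if_same.
under eq_bigr => b _ do rewrite (red (N + 2).+1 (fun b => if b is b'.+1 then Phi a b' else 0)).
under [RHS]eq_bigr => b _ do rewrite (red N.+1 (fun b => shift_coef1 b * Phi a b)).
apply: (@sum_ord_shift _ (fun b => G (N + 2).+1 (fun b _ _ => if b is b'.+1 then Phi a b' else 0) b 0 0)
   (fun b => G N.+1 (fun b _ _ => shift_coef1 b * Phi a b) b 0 0)) => [|b]; rewrite /G; first by rewrite mulr0 if_same.
have -> : (a + 2 * b.+1 + 3 * 0 + 4 * 0 == (N + 2).+1)%N = (a + 2 * b + 3 * 0 + 4 * 0 == N.+1)%N by lia.
by case: eqP => // h; rewrite type_weight1; [ring | lia].
Qed.

(** The number of nonzero parts minus 1, the largest part being positive. The rank formula at length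
    1 identifies it with the dimension of the span ([wrank1_span_dim]). *)
Definition span_dim b c d : nat :=
  if (0 < d)%N then 3 else if (0 < c)%N then 2 else if (0 < b)%N then 1 else 0.

(* The number of sequences of length s + k - 1 over F_2^3 whose entries span a
   space of dimension [h] and whose windows of length [s] have rank [i]. *)
Definition stratum h s k i : rat := profile_sum (s + k).-1 (fun a b c d =>
  ((span_dim b c d == h) && (trunc_sum s a b c d == i + s)%N)%:R).

Lemma eq_prof_sum N P Q : (forall a b c d, a + 2 * b + 3 * c + 4 * d = N.+1 -> P a b c d = Q a b c d)%N ->
  profile_sum N P = profile_sum N Q.
Proof.
move=> h; rewrite /profile_sum !big_seq; apply: eq_bigr => t /size_sequences ht.
rewrite /on_profile; have := profile_describes t.
by case: (profile t) => [[[[a b] c] d] q] [hn _ _ _]; apply: h; rewrite -ht.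
Qed.

Lemma profile_sumD N P Q : profile_sum N (fun a b c d => P a b c d + Q a b c d) = profile_sum N P + profile_sum N Q.
Proof.
rewrite /profile_sum -big_split /=; apply: eq_bigr => t _; rewrite /on_profile.
by case: (profile t) => [[[[a b] c] d] q].
Qed.

Lemma profile_sumZ N x P : profile_sum N (fun a b c d => x * P a b c d) = x * profile_sum N P.
Proof.
rewrite /profile_sum big_distrr /=; apply: eq_bigr => t _; rewrite /on_profile.
by case: (profile t) => [[[[a b] c] d] q].
Qed.

Lemma profile_sum_lin2 N x y P Q :
  x * profile_sum N P + y * profile_sum N Q = profile_sum N (fun a b c d => x * P a b c d + y * Q a b c d).
Proof. by rewrite profile_sumD !profile_sumZ. Qed.

Lemma profile_sum_lin3 N x y z P Q R :
  x * profile_sum N P + y * profile_sum N Q + z * profile_sum N R =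
  profile_sum N (fun a b c d => x * P a b c d + y * Q a b c d + z * R a b c d).
Proof. by rewrite !profile_sumD !profile_sumZ. Qed.

Lemma profile_sum_lin4 N x y z w P Q R T :
  x * profile_sum N P + y * profile_sum N Q + z * profile_sum N R + w * profile_sum N T =
  profile_sum N (fun a b c d => x * P a b c d + y * Q a b c d + z * R a b c d + w * T a b c d).
Proof. by rewrite !profile_sumD !profile_sumZ. Qed.

Lemma trunc_sum_shift s a b c d :
  [/\ trunc_sum s.+1 a b c d.+1 = trunc_sum s a b c d + 4,
      trunc_sum s.+1 a b c.+1 0 = trunc_sum s a b c 0 + 3 &
      trunc_sum s.+1 a b.+1 0 0 = trunc_sum s a b 0 0 + 2]%N.
Proof. by rewrite /trunc_sum; split; lia. Qed.

(** Lowering all four parts by 1 lowers [trunc_sum] by 4, that is, the height by 1 and the rank by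
    3. Some parts may become zero, hence all strata on the right. *)
Lemma stratum3_rec s k i : (0 < s)%N ->
  stratum 3 s.+1 (k + 3) (i + 3) = 4096 * stratum 3 s k i + 3840 * stratum 2 s k i + 3360 * stratum 1 s k i + 2520 * stratum 0 s k i.
Proof.
move=> s0; rewrite /stratum [RHS]profile_sum_lin4.
have -> : ((s.+1 + (k + 3)).-1 = (s + k).-1 + 4)%N by lia.
rewrite (@eq_prof_sum _ _ (fun a b c d => if d is d'.+1 then (trunc_sum s a b c d' == i + s)%N%:R else 0)).
  rewrite profile_sum3; apply: eq_prof_sum => a b c d _; rewrite /shift_coef3 /span_dim.
  by case: (0 < d)%N; case: (0 < c)%N; case: (0 < b)%N; rewrite /=; ring.
move=> a b c [|d] _; first by rewrite /span_dim /=; case: (0 < c)%N; case: (0 < b)%N.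
rewrite /span_dim ltn0Sn eqxx; have [-> _ _] := trunc_sum_shift s a b c d.
by congr (nat_of_bool _)%:R; lia.
Qed.

Lemma stratum2_rec s k i : (0 < s)%N ->
  stratum 2 s.+1 (k + 2) (i + 2) = 64 * stratum 2 s k i + 168 * stratum 1 s k i + 294 * stratum 0 s k i.
Proof.
move=> s0; rewrite /stratum [RHS]profile_sum_lin3.
have -> : ((s.+1 + (k + 2)).-1 = (s + k).-1 + 3)%N by lia.
rewrite (@eq_prof_sum _ _ (fun a b c d => if d is 0 then if c is c'.+1 then (trunc_sum s a b c' 0 == i + s)%N%:R else 0 else 0)).
  rewrite (profile_sum2 _ (fun a b c => (trunc_sum s a b c 0 == i + s)%N%:R)); apply: eq_prof_sum => a b c [|d] _; rewrite /shift_coef2 /span_dim.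
    by case: (0 < c)%N; case: (0 < b)%N; rewrite /=; ring.
  by rewrite /=; ring.
move=> a b [|c] [|d] _ //; first by rewrite /span_dim /=; case: (0 < b)%N.
rewrite /span_dim ltn0Sn eqxx; have [_ -> _] := trunc_sum_shift s a b c 0.
by congr (nat_of_bool _)%:R; lia.
Qed.

Lemma stratum1_rec s k i : (0 < s)%N ->
  stratum 1 s.+1 (k + 1) (i + 1) = 4 * stratum 1 s k i + 21 * stratum 0 s k i.
Proof.
move=> s0; rewrite /stratum [RHS]profile_sum_lin2.
have -> : ((s.+1 + (k + 1)).-1 = (s + k).-1 + 2)%N by lia.
rewrite (@eq_prof_sum _ _ (fun a b c d => if (c + d)%N is 0 then if b is b'.+1 then (trunc_sum s a b' 0 0 == i + s)%N%:R else 0 else 0)).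
  rewrite (profile_sum1 _ (fun a b => (trunc_sum s a b 0 0 == i + s)%N%:R)); apply: eq_prof_sum => a b [|c] [|d] _; rewrite /shift_coef1 /span_dim /=; try ring.
  by case: (0 < b)%N; rewrite /=; ring.
move=> a [|b] [|c] [|d] _ //; rewrite /span_dim ltn0Sn eqxx; have [_ _ ->] := trunc_sum_shift s a b 0 0.
by congr (nat_of_bool _)%:R; lia.
Qed.

Lemma wrank1_span_dim t : let: (a, b, c, d, q) := profile t in wrank 1 t = span_dim b c d.
Proof.
have := profile_describes t; case: (profile t) => [[[[a b] c] d] q] [hn hr _ _].
have := hr 1%N isT; rewrite /trunc_sum /span_dim.
by case: (posnP d) => [->|?]; case: (posnP c) => [->|?]; case: (posnP b) => [->|?]; lia.
Qed.

(** * Sequences by the dimension of their span *)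

Definition span_count h N : nat := \sum_(t <- sequences N) (wrank 1 t == h).

Lemma span_countE h N : (span_count h N)%:R = profile_sum N (fun a b c d => (span_dim b c d == h)%:R).
Proof.
rewrite natr_sum; apply: eq_bigr => t _; rewrite /on_profile; have := wrank1_span_dim t.
by case: (profile t) => [[[[a b] c] d] q] ->.
Qed.

Lemma wrank1_cons v t : wrank 1 (v :: t) = (wrank 1 t + ~~ first_dep 1 (v :: t))%N.
Proof. by rewrite wrank_cons // addn1. Qed.

Lemma card_first_dep1 t : #|[set v | first_dep 1 (v :: t)]| = (2 ^ wrank 1 t)%N.
Proof.
rewrite card_first_dep // first_dep0.
have -> : wrank 0 t = 0%N by apply/eqP; rewrite -leqn0; exact: rank_leq_col.
by rewrite subn0.
Qed.

Lemma span_countS h N : span_count h N.+1 =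
  (span_count h N * 2 ^ h + (if h is h'.+1 then span_count h' N * (8 - 2 ^ h') else 0))%N.
Proof.
rewrite /span_count /= big_allpairs_dep /=.
have E t : (\sum_(v <- enum {: V3}) (wrank 1 (v :: t) == h) =
  (wrank 1 t == h) * 2 ^ h + (if h is h'.+1 then (wrank 1 t == h') * (8 - 2 ^ h') else 0))%N.
  rewrite sum_enum_card.
  have -> : [set v | wrank 1 (v :: t) == h] =
     [set v | (wrank 1 t == h) && first_dep 1 (v :: t)] :|:
     [set v | ((wrank 1 t).+1 == h) && ~~ first_dep 1 (v :: t)].
    apply/setP => v; rewrite !inE wrank1_cons; case: (first_dep 1 _); rewrite /= ?addn0 ?andbT ?andbF ?orbF //.
    by rewrite addn1.
  rewrite cardsU.
  have -> : [set v | (wrank 1 t == h) && first_dep 1 (v :: t)] :&: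
     [set v | ((wrank 1 t).+1 == h) && ~~ first_dep 1 (v :: t)] = set0.
    by apply/setP => v; rewrite !inE; case: (first_dep 1 _); rewrite ?andbF ?andbT //.
  rewrite cards0 subn0.
  have c1 (e : bool) : #|[set v | e && first_dep 1 (v :: t)]| = (e * 2 ^ wrank 1 t)%N.
    by case: e; rewrite /= ?mul1n ?mul0n ?card_first_dep1 //; apply: eq_card0 => v; rewrite inE.
  have c2 (e : bool) : #|[set v | e && ~~ first_dep 1 (v :: t)]| = (e * (8 - 2 ^ wrank 1 t))%N.
    case: e; rewrite /= ?mul1n ?mul0n; last by apply: eq_card0 => v; rewrite inE.
    rewrite -card_first_dep1 -card_V3 -cardsT -cardsDS ?subsetT //; apply: eq_card => v.
    by rewrite !inE andbT.
  rewrite c1 c2; congr addn; first by case: eqP => [->|].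
  by case: h => [|h']; rewrite ?eqSS //; case: eqP => [->|].
under eq_bigr => t _ do rewrite E.
rewrite big_split /= -big_distrl /=; congr addn.
by case: h {E} => [|h']; rewrite -?big_distrl //= big1.
Qed.

(** The numbers of N x 3 matrices of rank h: the Gaussian binomials 1, 7, 7, 1 times the product of
    2^N - 2^i over i < h. *)
Lemma span_count_closed N (x := 2 ^+ N : rat) :
  [/\ (span_count 0 N)%:R = 1 :> rat, (span_count 1 N)%:R = 7 * (x - 1),
      (span_count 2 N)%:R = 7 * (x - 1) * (x - 2)
    & (span_count 3 N)%:R = (x - 1) * (x - 2) * (x - 4)].
Proof.
rewrite {}/x; elim: N => [|N [h0 h1 h2 h3]].
  have w0 : wrank 1 [::] = 0%N by apply/eqP; rewrite -leqn0; exact: rank_leq_row.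
  by rewrite /span_count !big_seq1 w0 expr0; split=> //=; ring.
have -> : span_count 0 N.+1 = span_count 0 N by rewrite span_countS muln1 addn0.
have -> : span_count 1 N.+1 = (span_count 1 N * 2 + span_count 0 N * 7)%N by rewrite span_countS.
have -> : span_count 2 N.+1 = (span_count 2 N * 4 + span_count 1 N * 6)%N by rewrite span_countS.
have -> : span_count 3 N.+1 = (span_count 3 N * 8 + span_count 2 N * 4)%N by rewrite span_countS.
rewrite exprS !natrD !natrM h0 h1 h2 h3; move: (2 ^+ N) => x.
by split; ring.
Qed.

Lemma stratum0E s k i : (0 < s)%N -> stratum 0 s k i = (i == 0)%N%:R.
Proof.
move=> s0; rewrite /stratum.
rewrite (@eq_prof_sum _ _ (fun a b c d => (i == 0)%N%:R * (span_dim b c d == 0)%N%:R)).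
  by rewrite profile_sumZ -span_countE; have [-> _ _ _] := span_count_closed (s + k).-1; rewrite mulr1.
move=> a b c d hn; rewrite -natrM mulnb; congr (nat_of_bool _)%:R; move: hn.
by rewrite /span_dim /trunc_sum; case: (posnP d) => [->|?]; case: (posnP c) => [->|?]; case: (posnP b) => [->|?]; rewrite ?andbF //=; lia.
Qed.

(** The rank is at least min(h, k): if the largest part is at least [s], the other h nonzero parts
    add at least h; otherwise no part is truncated and the rank is k. *)
Lemma stratum_small h s k i : (0 < s)%N -> (i < h)%N -> (i < k)%N -> stratum h s k i = 0.
Proof.
move=> s0 hi hk; rewrite /stratum (@eq_prof_sum _ _ (fun a b c d => 0 * 1)) ?profile_sumZ ?mul0r // => a b c d hn.
case: andP => // [[/eqP hc /eqP ht]]; exfalso; move: hn hc ht.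
by rewrite /span_dim /trunc_sum; case: (posnP d) => [->|?]; case: (posnP c) => [->|?]; case: (posnP b) => [->|?]; lia.
Qed.

Lemma stratum_square h s k : (0 < s)%N -> (k <= h)%N -> (h <= 3)%N -> stratum h s k k = (span_count h (s + k).-1)%:R.
Proof.
move=> s0 hk h3; rewrite /stratum span_countE; apply: eq_prof_sum => a b c d hn.
congr (nat_of_bool _)%:R; case: eqP => // hc; move: hc hn.
by rewrite /span_dim /trunc_sum; case: (posnP d) => [->|?]; case: (posnP c) => [->|?]; case: (posnP b) => [->|?]; lia.
Qed.

Lemma stratum_height1 h k i : (0 < h)%N -> stratum h 1 k i = (i == h)%N%:R * (span_count h k)%:R.
Proof.
move=> h0; rewrite /stratum span_countE add1n /= -profile_sumZ; apply: eq_prof_sum => a b c d hn.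
rewrite -natrM mulnb; congr (nat_of_bool _)%:R; move: hn.
by rewrite /span_dim /trunc_sum; case: (posnP d) => [->|?]; case: (posnP c) => [->|?]; case: (posnP b) => [->|?]; lia.
Qed.

(** Only h + 1 parts are nonzero, and each contributes at most [s]. *)
Lemma stratum_large h s k i : (0 < s)%N -> (h <= 3)%N -> (h * s < i)%N -> stratum h s k i = 0.
Proof.
move=> s0 h3 hi; rewrite /stratum (@eq_prof_sum _ _ (fun a b c d => 0 * 1)) ?profile_sumZ ?mul0r // => a b c d hn.
case: andP => // [[/eqP hc /eqP ht]]; exfalso; move: hi hn hc ht; rewrite /span_dim /trunc_sum.
by case: h h3 => [|[|[|[|]]]] // _; case: (posnP d) => [->|?]; case: (posnP c) => [->|?]; case: (posnP b) => [->|?]; lia.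
Qed.

(** * From triple persymmetric matrices to sequences of vectors *)

Lemma eq_ker_rank (F : fieldType) (k m n : nat) (A : 'M[F]_(k, m)) (B : 'M[F]_(k, n)) :
  (forall Z : 'rV[F]_k, Z *m A = 0 <-> Z *m B = 0) -> \rank A = \rank B.
Proof.
move=> h.
have sub (p q : nat) (C : 'M[F]_(k, p)) (D : 'M[F]_(k, q)) :
    (forall Z : 'rV[F]_k, Z *m C = 0 -> Z *m D = 0) -> (kermx C <= kermx D)%MS.
  move=> hCD; apply/row_subP => i; apply/sub_kermxP; apply: hCD.
  by apply/sub_kermxP; apply: row_sub.
have e : \rank (kermx A) = \rank (kermx B).
  by apply: eqmx_rank; apply/andP; split; apply: sub => Z; apply h.
by move: e; rewrite !mxrank_ker; have := rank_leq_row A; have := rank_leq_row B; lia.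
Qed.

Definition hankel s k (t : seq V3) (m : 'I_3) : 'M['F_2]_(s, k) :=
  \matrix_(i, j) nth 0 t (i + j) 0 m.

Definition triple_hankel s k t : 'M['F_2]_(s + (s + s), k) :=
  col_mx (hankel s k t 0) (col_mx (hankel s k t 1) (hankel s k t 2)).

Lemma mul_windows_eq0 k s t (Z : 'rV_k) : Z *m windows t k s = 0 <->
  forall (i : 'I_s) (m : 'I_3), \sum_j Z 0 j * nth 0 t (i + j) 0 m = 0.
Proof.
elim: s t => [|s IH] t.
  by split=> [_ []|_] //; apply/matrixP => i [].
rewrite [windows _ _ _]/= (mul_mx_row Z); split.
  move/eqP; rewrite row_mx_eq0 => /andP [/eqP h1 /eqP /IH h2] i m.
  case: (unliftP ord0 i) => [i'|] -> /=.
    rewrite -[RHS](h2 i' m); apply: eq_bigr => j _.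
    by rewrite nth_behead.
  move/rowP/(_ m): h1; rewrite !mxE => h1; rewrite -[RHS]h1; apply: eq_bigr => j _; by rewrite !mxE.
move=> h; rewrite -[RHS]row_mx0; congr row_mx.
  apply/rowP => m; rewrite !mxE -[RHS](h ord0 m); apply: eq_bigr => j _; by rewrite !mxE.
apply/IH => i m; rewrite -[RHS](h (lift ord0 i) m); apply: eq_bigr => j _.
by rewrite nth_behead.
Qed.

(** The matrix of windows is the transpose of the triple matrix up to a permutation of columns.
    Comparing left kernels avoids writing that permutation down. *)
Lemma rank_triple_hankel s k t : size t = (s + k).-1 -> (0 < k)%N -> \rank (triple_hankel s k t) = wrank s t.
Proof.
move=> ht k0; rewrite /wrank ht; have -> : ((s + k).-1 + 1 - s = k)%N by lia.
rewrite -mxrank_tr; apply: eq_ker_rank => Z.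
have ZH m : Z *m (hankel s k t m)^T = 0 <-> forall i : 'I_s, \sum_j Z 0 j * nth 0 t (i + j) 0 m = 0.
  split=> [/rowP h i | h].
    by move: (h i); rewrite !mxE => hi; rewrite -[RHS]hi; apply: eq_bigr => j _; rewrite !mxE.
  by apply/rowP => i; rewrite !mxE -[RHS](h i); apply: eq_bigr => j _; rewrite !mxE.
apply: (iff_trans _ (iff_sym (mul_windows_eq0 s t Z))).
rewrite /triple_hankel !tr_col_mx !mul_mx_row; split.
  move/eqP; rewrite !row_mx_eq0 => /and3P [/eqP /ZH h0 /eqP /ZH h1 /eqP /ZH h2] i m.
  have [->|[->|->]] : m = 0 \/ m = 1 \/ m = 2.
    by case: m => [[|[|[|m]]] hm] //; [left|right; left|right; right]; apply: val_inj.
  - exact: h0. - exact: h1. - exact: h2.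
move=> h; rewrite (iffRL (ZH 0)) ?(iffRL (ZH 1)) ?(iffRL (ZH 2)) ?row_mx0 // => i; exact: h.
Qed.

Lemma persymmetric_hankel s k t m : persymmetric (hankel s k t m).
Proof.
by apply/forallP => i; apply/forallP => j; apply/forallP => r; apply/forallP => l; apply/implyP => /eqP e; rewrite !mxE e.
Qed.

Lemma mem_sequences N t : (t \in sequences N) = (size t == N).
Proof.
apply/idP/eqP => [/size_sequences //|]; elim: N t => [|N IH] [|v t] //= [ht].
by apply/allpairsP; exists (t, v); rewrite /= IH // mem_enum.
Qed.

Lemma uniq_sequences N : uniq (sequences N).
Proof.
elim: N => [|N IH] //=; apply: allpairs_uniq => //; first exact: enum_uniq.
by move=> [t v] [t' v'] _ _ /= [-> ->].
Qed.

(** Reads each matrix down its first column and then along its last row, so every antidiagonal is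
    met once; the truncated [n - s] is 0 on the first stretch. *)
Definition diag_seq s k (A B C : 'M['F_2]_(s.+1, k.+1)) : seq V3 :=
  mkseq (fun n => let i := inord (minn n s) in let j := inord (n - s) in
    \row_(m < 3) (if m == 0 then A i j else if m == 1 then B i j else C i j)) (s.+1 + k).

Lemma hankel_diag_seq s k (A B C : 'M['F_2]_(s.+1, k.+1)) :
  persymmetric A -> persymmetric B -> persymmetric C ->
  [/\ hankel s.+1 k.+1 (diag_seq A B C) 0 = A, hankel s.+1 k.+1 (diag_seq A B C) 1 = B
    & hankel s.+1 k.+1 (diag_seq A B C) 2 = C].
Proof.
have P (M : 'M['F_2]_(s.+1, k.+1)) (i : 'I_s.+1) (j : 'I_k.+1) : persymmetric M ->
    M (inord (minn (i + j) s)) (inord (i + j - s)) = M i j.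
  move=> /forallP /(_ (inord (minn (i + j) s))) /forallP /(_ (inord (i + j - s))).
  move=> /forallP /(_ i) /forallP /(_ j) /implyP h; apply/eqP/h.
  have hi := ltn_ord i; have hj := ltn_ord j.
  rewrite (@inordK s) ?(@inordK k); [apply/eqP; lia|lia|lia].
move=> hA hB hC.
have N (i : 'I_s.+1) (j : 'I_k.+1) : (i + j < s.+1 + k)%N by have := ltn_ord i; have := ltn_ord j; lia.
by split; apply/matrixP => i j; rewrite !mxE nth_mkseq // !mxE /= P.
Qed.

Lemma triple_hankel_inj s k t t' : size t = (s.+1 + k)%N -> size t' = (s.+1 + k)%N ->
  triple_hankel s.+1 k.+1 t = triple_hankel s.+1 k.+1 t' -> t = t'.
Proof.
move=> ht ht' /eq_col_mx [h0 /eq_col_mx [h1 h2]].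
apply: (@eq_from_nth _ 0); rewrite ?ht // => n hn.
have e : (n = (inord (minn n s) : 'I_s.+1) + (inord (n - s) : 'I_k.+1))%N by rewrite (@inordK s) ?(@inordK k); lia.
have H m : hankel s.+1 k.+1 t m = hankel s.+1 k.+1 t' m -> nth 0 t n 0 m = nth 0 t' n 0 m.
  by move/matrixP/(_ (inord (minn n s)) (inord (n - s))); rewrite !mxE -e.
apply/rowP => m.
have [->|[->|->]] : m = 0 \/ m = 1 \/ m = 2.
  by case: m => [[|[|[|m]]] hm] //; [left|right; left|right; right]; apply: val_inj.
- exact: H h0. - exact: H h1. - exact: H h2.
Qed.

Lemma Gamma_sequences i s k : Gamma i s.+1 s.+1 s.+1 k.+1 =
  (\sum_(t <- sequences (s.+1 + k)) (wrank s.+1 t == i))%N.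
Proof.
pose L := [seq triple_hankel s.+1 k.+1 t | t <- sequences (s.+1 + k) & wrank s.+1 t == i].
transitivity (size L); last first.
  by rewrite size_map size_filter -sum1_count big_mkcond; apply: eq_bigr => t _; case: ifP.
rewrite /Gamma; have /card_uniqP <- : uniq L.
  rewrite map_inj_in_uniq ?filter_uniq ?uniq_sequences // => t t'.
  rewrite !mem_filter !mem_sequences => /andP [_ /eqP ht] /andP [_ /eqP ht'].
  exact: triple_hankel_inj.
apply: eq_card => M; rewrite inE; apply/andP/mapP => [[/and3P [hA hB hC] /eqP hr]|[t]].
  have [e0 e1 e2] := hankel_diag_seq hA hB hC.
  have [t [sz eM]] : exists t, size t = (s.+1 + k)%N /\ M = triple_hankel s.+1 k.+1 t.
    exists (diag_seq (usubmx M) (usubmx (dsubmx M)) (dsubmx (dsubmx M))).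
    by rewrite size_mkseq /triple_hankel e0 e1 e2 !vsubmxK.
  exists t => //.
  by rewrite mem_filter mem_sequences sz eqxx andbT -hr eM rank_triple_hankel // sz addnS.
rewrite mem_filter mem_sequences => /andP [/eqP hr /eqP ht] ->; split; last first.
  by rewrite rank_triple_hankel ?ht ?addnS // hr.
by rewrite /triple_persymmetric /triple_hankel col_mxKu !col_mxKd col_mxKu !persymmetric_hankel.
Qed.

Lemma GammaE i s k : (0 < s)%N -> (0 < k)%N ->
  (Gamma i s s s k)%:R = stratum 3 s k i + stratum 2 s k i + stratum 1 s k i + stratum 0 s k i.
Proof.
case: s k => [|s] [|k] // _ _; rewrite Gamma_sequences natr_sum.
transitivity (profile_sum (s.+1 + k) (fun a b c d => (trunc_sum s.+1 a b c d == i + s.+1)%N%:R)).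
  rewrite /profile_sum !big_seq; apply: eq_bigr => t /size_sequences ht; rewrite /on_profile.
  have := profile_describes t; case: (profile t) => [[[[a b] c] d] q] [_ hr _ _].
  by have := hr s.+1; rewrite ht => /(_ ltac:(lia)) <-; congr (nat_of_bool _)%:R; lia.
rewrite /stratum (addnS s.+1 k) -!profile_sumD; apply: eq_prof_sum => a b c d _.
by rewrite /span_dim; case: (0 < d)%N; case: (0 < c)%N; case: (0 < b)%N; rewrite /= ?addr0 ?add0r.
Qed.

(** * Closed forms *)

Local Notation pw n := (2 ^+ n : rat).

Lemma pwD m n : pw (m + n) = pw m * pw n. Proof. exact: exprD. Qed.
Lemma pwS n : pw n.+1 = 2 * pw n. Proof. exact: exprS. Qed.
Lemma pw0 : pw 0 = 1. Proof. by []. Qed.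

Lemma stratum0_pos s k i : (0 < s)%N -> (0 < i)%N -> stratum 0 s k i = 0.
Proof. by move=> s0 i0; rewrite stratum0E // -leqn0 leqNgt i0. Qed.

Lemma stratum0_0 s k : (0 < s)%N -> stratum 0 s k 0 = 1.
Proof. by move=> s0; rewrite stratum0E. Qed.

Lemma leq_addP n m : (m <= n)%N -> exists p, n = (p + m)%N.
Proof. by move=> h; exists (n - m)%N; rewrite subnK. Qed.

Lemma span_count1 N : (span_count 1 N)%:R = 7 * (pw N - 1).
Proof. by have [] := span_count_closed N. Qed.
Lemma span_count2 N : (span_count 2 N)%:R = 7 * (pw N - 1) * (pw N - 2).
Proof. by have [] := span_count_closed N. Qed.
Lemma span_count3 N : (span_count 3 N)%:R = (pw N - 1) * (pw N - 2) * (pw N - 4).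
Proof. by have [] := span_count_closed N. Qed.

Ltac pow_field := rewrite ?pwS ?pwD ?pwS ?pw0; field; exact: isT.

Lemma stratum_height1_neq h k i : (0 < h)%N -> (i != h)%N -> stratum h 1 k i = 0.
Proof. by move=> h0 /negbTE hi; rewrite stratum_height1 // hi mul0r. Qed.

Lemma stratum_height1_eq h k : (0 < h)%N -> stratum h 1 k h = (span_count h k)%:R.
Proof. by move=> h0; rewrite stratum_height1 // eqxx mul1r. Qed.

Lemma stratum1_low s k i : (0 < i)%N -> (i < s)%N -> (i < k)%N -> stratum 1 s k i = 21 / 4 * pw i ^+ 2.
Proof.
elim: s k i => [|s IH] k i i0 hs hk; first by exfalso; lia.
have [i' ei] : exists i', i = (i' + 1)%N by apply: leq_addP.
have [k' ek] : exists k', k = (k' + 1)%N by apply: leq_addP; lia.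
subst i k; rewrite stratum1_rec; last lia.
(* At i' = 0 the only contribution is the zero sequence, with coefficient 21 = 21/4 * 2^2; this
   fixes the constant of the formula. *)
case: (posnP i') => [->|i'0].
  rewrite stratum_small ?stratum0_0; try lia; pow_field.
rewrite IH ?stratum0_pos; try lia; pow_field.
Qed.

Lemma stratum1_top s k : (0 < s)%N -> (s <= k)%N -> stratum 1 s k s = 7 / 2 * pw s * pw k - 7 / 4 * pw s ^+ 2.
Proof.
case: s => [h|s _]; first by exfalso; lia.
elim: s k => [|s IH] k hk.
  rewrite stratum_height1_eq ?span_count1; try lia; pow_field.
have [k' ek] : exists k', k = (k' + 1)%N by apply: leq_addP; lia.
subst k; rewrite -[X in stratum _ _ _ X]addn1 stratum1_rec ?IH ?stratum0_pos; try lia; pow_field.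
Qed.

Lemma stratum2_low s k i : (0 < i)%N -> (i <= s)%N -> (i < k)%N ->
  stratum 2 s k i = 147 / 16 * pw i ^+ 3 - 147 / 8 * pw i ^+ 2.
Proof.
elim: s k i => [|s IH] k i i0 hs hk; first by exfalso; lia.
case: (ltnP i 2) => i2.
  have ei : i = 1%N by lia.
  subst i; rewrite stratum_small; try lia; pow_field.
have [i' ei] : exists i', i = (i' + 2)%N by apply: leq_addP.
have [k' ek] : exists k', k = (k' + 2)%N by apply: leq_addP; lia.
subst i k; rewrite stratum2_rec; last lia.
case: (posnP i') => [->|i'0].
  rewrite (@stratum_small 2) ?(@stratum_small 1) ?stratum0_0; try lia; pow_field.
rewrite IH ?stratum1_low ?stratum0_pos; try lia; pow_field.
Qed.

Lemma stratum2_mid s j k : (0 < j)%N -> (j < s)%N -> (s + j < k)%N ->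
  stratum 2 s k (s + j) = 147 / 16 * pw s * pw k * pw j ^+ 3 - 735 / 32 * pw s ^+ 2 * pw j ^+ 4
    + 147 / 16 * pw s ^+ 3 * pw j ^+ 3.
Proof.
elim: s j k => [|s IH] j k j0 hj hk; first by exfalso; lia.
have [k' ek] : exists k', k = (k' + 2)%N by apply: leq_addP; lia.
have [j' ej] : exists j', j = (j' + 1)%N by apply: leq_addP; lia.
subst k j; have -> : (s.+1 + (j' + 1) = s + j' + 2)%N by lia.
rewrite stratum2_rec; last lia.
case: (posnP j') => [->|j'0].
  rewrite addn0 stratum2_low ?stratum1_top ?stratum0_pos; try lia; pow_field.
rewrite IH ?(@stratum_large 1) ?stratum0_pos; try lia; pow_field.
Qed.

Lemma stratum2_top s k : (0 < s)%N -> (2 * s <= k)%N ->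
  stratum 2 s k (2 * s) = 7 / 4 * pw s ^+ 2 * pw k ^+ 2 - 21 / 16 * pw s ^+ 4 * pw k + 7 / 32 * pw s ^+ 6.
Proof.
case: s => [h|s _]; first by exfalso; lia.
elim: s k => [|s IH] k hk.
  rewrite muln1 stratum_height1_eq ?span_count2; try lia; pow_field.
have [k' ek] : exists k', k = (k' + 2)%N by apply: leq_addP; lia.
subst k; have -> : (2 * s.+2 = 2 * s.+1 + 2)%N by lia.
rewrite stratum2_rec ?IH ?(@stratum_large 1) ?stratum0_pos; try lia; pow_field.
Qed.

Lemma stratum3_low s k i : (0 < i)%N -> (i <= s)%N -> (i < k)%N ->
  stratum 3 s k i = 105 / 8 * pw i ^+ 2 - 315 / 32 * pw i ^+ 3 + 105 / 64 * pw i ^+ 4.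
Proof.
elim: s k i => [|s IH] k i i0 hs hk; first by exfalso; lia.
(* Rank 1 or 2 is too small for a span of dimension 3 when i < k; the formula has zeros there. *)
case: (ltnP i 3) => i3.
  have [ei|ei] : i = 1%N \/ i = 2%N by lia.
    subst i; rewrite stratum_small; try lia; pow_field.
  subst i; rewrite stratum_small; try lia; pow_field.
have [i' ei] : exists i', i = (i' + 3)%N by apply: leq_addP.
have [k' ek] : exists k', k = (k' + 3)%N by apply: leq_addP; lia.
subst i k; rewrite stratum3_rec; last lia.
case: (posnP i') => [->|i'0].
  rewrite (@stratum_small 3) ?(@stratum_small 2) ?(@stratum_small 1) ?stratum0_0; try lia; pow_field.
rewrite IH ?stratum2_low ?stratum1_low ?stratum0_pos; try lia; pow_field.
Qed.

Lemma stratum3_mid s j k : (0 < j)%N -> (j < s)%N -> (s + j < k)%N ->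
  stratum 3 s k (s + j) = - (735 / 64) * pw s * pw k * pw j ^+ 3 + 735 / 128 * pw s * pw k * pw j ^+ 4
    + 3675 / 128 * pw s ^+ 2 * pw j ^+ 4 - 3255 / 256 * pw s ^+ 2 * pw j ^+ 5
    - 315 / 32 * pw s ^+ 3 * pw j ^+ 3 + 105 / 64 * pw s ^+ 4 * pw j ^+ 4.
Proof.
elim: s j k => [|s IH] j k j0 hj hk; first by exfalso; lia.
have [k' ek] : exists k', k = (k' + 3)%N by apply: leq_addP; lia.
subst k; case: (ltnP j 3) => j3; last first.
  have [j' ej] : exists j', j = (j' + 2)%N by apply: leq_addP; lia.
  subst j; have -> : (s.+1 + (j' + 2) = s + j' + 3)%N by lia.
  rewrite stratum3_rec ?IH ?stratum2_mid ?(@stratum_large 1) ?stratum0_pos; try lia; pow_field.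
(* The recursion lowers [j] by 2, so these two values lead to rank s - 1 or s at height s, in the
   range of the low formulas. *)
have [ej|ej] : j = 1%N \/ j = 2%N by lia.
  subst j; case: s IH hj hk => [|[|s]] IH hj hk; first by exfalso; lia.
    rewrite (stratum3_rec k' 0) ?(@stratum_small 3) ?(@stratum_small 2) ?(@stratum_small 1) ?stratum0_0; try lia; pow_field.
  have -> : (s.+3 + 1 = s.+1 + 3)%N by lia.
  rewrite stratum3_rec ?stratum3_low ?stratum2_low ?stratum1_low ?stratum0_pos; try lia; pow_field.
subst j; have -> : (s.+1 + 2 = s + 3)%N by lia.
rewrite stratum3_rec ?stratum3_low ?stratum2_low ?stratum1_top ?stratum0_pos; try lia; pow_field.
Qed.

(** [stratum3_mid] continued to j = s: one step of the recursion reaches height s - 1 and rank (s -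
    1) + (s - 2), still in the middle range once s is at least 3. *)
Lemma stratum3_double s k : (0 < s)%N -> (2 * s < k)%N ->
  stratum 3 s k (2 * s) = - (735 / 64) * pw s ^+ 4 * pw k + 735 / 128 * pw s ^+ 5 * pw k
    + 2415 / 128 * pw s ^+ 6 - 3255 / 256 * pw s ^+ 7 + 105 / 64 * pw s ^+ 8.
Proof.
case: s => [|[|[|s]]] s0 hk; first by exfalso; lia.
- rewrite muln1 stratum_height1_neq; try lia; pow_field.
- have [k' ek] : exists k', k = (k' + 3)%N by apply: leq_addP; lia.
  subst k; rewrite (stratum3_rec k' 1) ?(@stratum_small 3) ?(@stratum_small 2) ?stratum1_top ?stratum0_pos; try lia; pow_field.
have [k' ek] : exists k', k = (k' + 3)%N by apply: leq_addP; lia.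
subst k; have -> : (2 * s.+3 = s.+2 + s.+1 + 3)%N by lia.
rewrite stratum3_rec ?stratum3_mid ?stratum2_mid ?(@stratum_large 1) ?stratum0_pos; try lia; pow_field.
Qed.

Lemma stratum3_high s j k : (j + 2 <= s)%N -> (2 * s + 1 + j < k)%N ->
  stratum 3 s k (2 * s + 1 + j) =
   105 / 4 * (pw k ^+ 2 * pw s ^+ 2 * pw j ^+ 4) + 735 / 8 * (pw k * pw s ^+ 5 * pw j ^+ 4)
   - 3255 / 8 * (pw k * pw s ^+ 4 * pw j ^+ 5) + 105 / 4 * (pw s ^+ 8 * pw j ^+ 4)
   - 3255 / 8 * (pw s ^+ 7 * pw j ^+ 5) + 9765 / 8 * (pw s ^+ 6 * pw j ^+ 6).
Proof.
elim: s j k => [|s IH] j k hj hk; first by exfalso; lia.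
have [k' ek] : exists k', k = (k' + 3)%N by apply: leq_addP; lia.
subst k; case: j hj hk => [|j] hj hk.
  have -> : (2 * s.+1 + 1 + 0 = 2 * s + 3)%N by lia.
  rewrite stratum3_rec ?stratum3_double ?stratum2_top ?(@stratum_large 1) ?stratum0_pos; try lia; pow_field.
have -> : (2 * s.+1 + 1 + j.+1 = 2 * s + 1 + j + 3)%N by lia.
rewrite stratum3_rec ?IH ?(@stratum_large 2) ?(@stratum_large 1) ?stratum0_pos; try lia; pow_field.
Qed.

(** Above rank 2s only stratum 3 survives, and each step multiplies it by 4096 = 16^3. *)
Lemma stratum3_reduction s k i j : (0 < s)%N -> (2 * s < i)%N ->
  stratum 3 (s + j) (k + 3 * j) (i + 3 * j) = (16 ^ (3 * j))%N%:R * stratum 3 s k i.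
Proof.
move=> s0 hi; elim: j => [|j IH]; first by rewrite !addn0 mul1r.
have -> : (s + j.+1 = (s + j).+1)%N by lia.
have -> : (k + 3 * j.+1 = k + 3 * j + 3)%N by lia.
have -> : (i + 3 * j.+1 = i + 3 * j + 3)%N by lia.
rewrite stratum3_rec ?(@stratum_large 2) ?(@stratum_large 1) ?stratum0_pos; try lia.
have -> : (16 ^ (3 * j.+1) = 4096 * 16 ^ (3 * j))%N by rewrite mulnS expnD.
have comb (w x y z u v : rat) : w * (u * v) + x * 0 + y * 0 + z * 0 = w * u * v by ring.
rewrite IH natrM; exact: comb.
Qed.

(** * Closed forms for width equal to the rank *)

Lemma square1_low s k : (0 < s)%N -> (0 < k)%N -> (k <= s + 1)%N ->
  stratum 1 s k k = 7 / 2 * pw s * pw k - 7 / 4 * pw k ^+ 2.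
Proof.
elim: s k => [|s IH] k s0 k0 hk; first by exfalso; lia.
case: (ltnP k 2) => k2.
  have ek : k = 1%N by lia.
  subst k; rewrite stratum_square ?span_count1 ?addn1; try lia; pow_field.
have [k' ek] : exists k', k = (k' + 1)%N by apply: leq_addP; lia.
subst k; case: (posnP s) => [es|s1].
  have ek : k' = 1%N by lia.
  subst s k'; rewrite stratum_height1_neq; try lia; pow_field.
rewrite stratum1_rec ?IH ?stratum0_pos; try lia; pow_field.
Qed.

(** The recursion preserves k = i. Its base values come from [stratum_square]: for k at most h,
    every sequence with span of dimension h has rank k. *)
Lemma square2_low s k : (0 < s)%N -> (0 < k)%N -> (k <= s + 1)%N ->
  stratum 2 s k k = 49 / 8 * pw k ^+ 2 - 21 / 16 * pw k ^+ 3 - 21 / 2 * pw s * pw k + 7 / 4 * pw s ^+ 2 * pw k ^+ 2.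
Proof.
elim: s k => [|s IH] k s0 k0 hk; first by exfalso; lia.
case: (ltnP k 3) => k3.
  have [ek|ek] : k = 1%N \/ k = 2%N by lia.
    subst k; rewrite stratum_square ?span_count2 ?addn1; try lia; pow_field.
  subst k; rewrite stratum_square ?span_count2 ?addn2; try lia; pow_field.
have [k' ek] : exists k', k = (k' + 2)%N by apply: leq_addP; lia.
subst k; rewrite stratum2_rec ?IH ?square1_low ?stratum0_pos; try lia; pow_field.
Qed.

Lemma square2_mid s j : (0 < s)%N -> (0 < j)%N -> (j <= s + 1)%N ->
  stratum 2 s (s + j) (s + j) = 7 / 32 * pw s ^+ 2 * pw j ^+ 4 - 21 / 16 * pw s ^+ 3 * pw j ^+ 3 + 7 / 4 * pw s ^+ 4 * pw j ^+ 2.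
Proof.
elim: s j => [|s IH] j s0 j0 hj; first by exfalso; lia.
case: (posnP s) => [es|s1].
  subst s; have [ej|ej] : j = 1%N \/ j = 2%N by lia.
    subst j; rewrite stratum_height1_eq ?span_count2; try lia; pow_field.
  subst j; rewrite stratum_height1_neq; try lia; pow_field.
have [j' ej] : exists j', j = (j' + 1)%N by apply: leq_addP; lia.
subst j; have -> : (s.+1 + (j' + 1) = s + j' + 2)%N by lia.
rewrite stratum2_rec; last lia.
case: (posnP j') => [->|j'0].
  rewrite addn0 square2_low ?square1_low ?stratum0_pos; try lia; pow_field.
rewrite IH ?(@stratum_large 1) ?stratum0_pos; try lia; pow_field.
Qed.

Lemma square3_low s k : (0 < s)%N -> (0 < k)%N -> (k <= s + 1)%N ->
  stratum 3 s k k = - (35 / 8) * pw k ^+ 2 + 45 / 32 * pw k ^+ 3 - 7 / 64 * pw k ^+ 4 + 7 * pw s * pw k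
    - 7 / 4 * pw s ^+ 2 * pw k ^+ 2 + 1 / 8 * pw s ^+ 3 * pw k ^+ 3.
Proof.
elim: s k => [|s IH] k s0 k0 hk; first by exfalso; lia.
case: (ltnP k 4) => k4.
  have [ek|[ek|ek]] : k = 1%N \/ k = 2%N \/ k = 3%N by lia.
  - subst k; rewrite stratum_square ?span_count3 ?addn1; try lia; pow_field.
  - subst k; rewrite stratum_square ?span_count3 ?addn2; try lia; pow_field.
  - subst k; rewrite stratum_square ?span_count3 ?addn3; try lia; pow_field.
have [k' ek] : exists k', k = (k' + 3)%N by apply: leq_addP; lia.
subst k; rewrite stratum3_rec ?IH ?square2_low ?square1_low ?stratum0_pos; try lia; pow_field.
Qed.

Lemma square3_mid s j : (0 < s)%N -> (0 < j)%N -> (j <= s + 1)%N ->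
  stratum 3 s (s + j) (s + j) = - (35 / 128) * pw s ^+ 2 * pw j ^+ 4 + 7 / 256 * pw s ^+ 2 * pw j ^+ 5
    + 45 / 32 * pw s ^+ 3 * pw j ^+ 3 - 7 / 4 * pw s ^+ 4 * pw j ^+ 2 - 7 / 64 * pw s ^+ 4 * pw j ^+ 4
    + 1 / 8 * pw s ^+ 6 * pw j ^+ 3.
Proof.
elim: s j => [|s IH] j s0 j0 hj; first by exfalso; lia.
case: (ltnP (s.+1 + j) 4) => hsj.
  have [[es ej]|[[es ej]|[es ej]]] : (s = 0%N /\ j = 1%N) \/ (s = 0%N /\ j = 2%N) \/ (s = 1%N /\ j = 1%N) by lia.
  - subst s j; rewrite stratum_square ?span_count3; try lia; pow_field.
  - subst s j; rewrite stratum_square ?span_count3; try lia; pow_field.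
  - subst s j; rewrite stratum_square ?span_count3; try lia; pow_field.
case: (ltnP j 3) => j3; last first.
  have [j' ej] : exists j', j = (j' + 2)%N by apply: leq_addP; lia.
  subst j; have -> : (s.+1 + (j' + 2) = s + j' + 3)%N by lia.
  rewrite stratum3_rec ?IH ?square2_mid ?(@stratum_large 1) ?stratum0_pos; try lia; pow_field.
have [ej|ej] : j = 1%N \/ j = 2%N by lia.
  subst j; have [s' es] : exists s', s = (s' + 1)%N by apply: leq_addP; lia.
  subst s; have -> : ((s' + 1).+1 + 1 = s' + 3)%N by lia.
  rewrite stratum3_rec ?square3_low ?square2_low ?square1_low ?stratum0_pos; try lia; pow_field.
subst j; have -> : (s.+1 + 2 = s + 3)%N by lia.
rewrite stratum3_rec ?square3_low ?square2_low ?square1_low ?stratum0_pos; try lia; pow_field.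
Qed.

Lemma stratum3_top s k : (0 < s)%N -> (3 * s <= k)%N ->
  stratum 3 s k (3 * s) = 1 / 8 * pw k ^+ 3 * pw s ^+ 3 - 7 / 64 * pw k ^+ 2 * pw s ^+ 6
   + 7 / 256 * pw k * pw s ^+ 9 - 1 / 512 * pw s ^+ 12.
Proof.
case: s => [h|s _]; first by exfalso; lia.
elim: s k => [|s IH] k hk.
  rewrite muln1 stratum_height1_eq ?span_count3; try lia; pow_field.
have [k' ek] : exists k', k = (k' + 3)%N by apply: leq_addP; lia.
subst k; have -> : (3 * s.+2 = 3 * s.+1 + 3)%N by lia.
rewrite stratum3_rec ?IH ?(@stratum_large 2) ?(@stratum_large 1) ?stratum0_pos; try lia; pow_field.
Qed.

Lemma exp16_pow j : (16 ^ (3 * j))%N%:R = pw j ^+ 12.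
Proof.
have -> : (16 ^ (3 * j) = 2 ^ (j * 12))%N.
  by rewrite -[16%N]/(2 ^ 4)%N -expnM; congr (2 ^ _)%N; lia.
by rewrite natrX exprM.
Qed.

Lemma square3_high s j : (0 < s)%N -> stratum 3 (s + j) (2 * s + 1 + 3 * j) (2 * s + 1 + 3 * j) =
  pw j ^+ 12 * (pw s ^+ 9 - 7 / 4 * pw s ^+ 8 + 7 / 8 * pw s ^+ 7 - 1 / 8 * pw s ^+ 6).
Proof.
move=> s0; rewrite stratum3_reduction ?exp16_pow; try lia.
(* Rank 2s + 1 is the upper end j = s + 1 of [square3_mid]. *)
have -> : (2 * s + 1 = s + (s + 1))%N by lia.
rewrite square3_mid; try lia; pow_field.
Qed.

(** * Return to [Gamma] and proof of the theorem *)

Lemma Gamma_width0 s : Gamma 0 s s s 0 = 1%N.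
Proof.
rewrite /Gamma -[RHS](cards1 (0 : 'M['F_2]_(s + (s + s), 0))); apply: eq_card => M.
have -> : M = 0 by apply/matrixP => i [].
rewrite !inE eqxx mxrank0 eqxx andbT.
have P (A : 'M['F_2]_(s, 0)) : persymmetric A by apply/forallP => i; apply/forallP => [[]].
by rewrite /triple_persymmetric !P.
Qed.

(** The exponents of the theorem are integers and can be negative (4i - 6 at i = 1). These rules
    turn the powers into monomials in natural powers of 2, on which [field] decides. *)
Lemma two_expzD (m n : int) : 2 ^ (m + n) = 2 ^ m * 2 ^ n :> rat.
Proof. by rewrite expfzDr. Qed.
Lemma two_expzM (c n : nat) : 2 ^ (c%:R * n%:Z) = pw n ^+ c.
Proof. by rewrite natz -PoszM -exprnP mulnC exprM. Qed.
Lemma two_expzP (n : nat) : 2 ^ n%:Z = pw n.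
Proof. by []. Qed.
Lemma two_expzN (c : nat) : 2 ^ (- c%:R) = (pw c)^-1.
Proof. by rewrite natz -exprnN. Qed.
Lemma two_expzN1 : 2 ^ (- 1) = 2^-1 :> rat.
Proof. by []. Qed.

Ltac two_expz := rewrite ?two_expzD ?two_expzM ?two_expzN ?two_expzN1 ?two_expzP.

Lemma Gamma_high i s k : (0 < s)%N -> (0 < k)%N -> (2 * s < i)%N ->
  (Gamma i s s s k)%:R = stratum 3 s k i.
Proof.
move=> s0 k0 hi; rewrite GammaE // (@stratum_large 2) ?(@stratum_large 1) ?stratum0_pos ?addr0 //; lia.
Qed.

Lemma Gamma_reduction s k i j : (0 < s)%N -> (0 < k)%N -> (2 * s < i)%N ->
  Gamma (i + 3 * j) (s + j) (s + j) (s + j) (k + 3 * j) = (16 ^ (3 * j) * Gamma i s s s k)%N.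
Proof.
move=> s0 k0 hi; apply/eqP; rewrite -(eqr_nat rat) natrM !Gamma_high; try lia.
by rewrite stratum3_reduction.
Qed.

Theorem theorem3p2 (s : nat) (hs : (1 <= s)%N) :
  (* rank i, arbitrary width k *)
  ((forall k : nat, (Gamma 0 s s s k)%:R = 1 :> rat) /\
   (forall i k : nat, (1 <= i)%N -> (i + 1 <= s)%N -> (i + 1 <= k)%N ->
      (Gamma i s s s k)%:R
      = 105 * 2 ^ (4 * i%:Z - 6) - 21 * 2 ^ (3 * i%:Z - 5) :> rat) /\
   (forall k : nat, (s + 1 <= k)%N ->
      (Gamma s s s s k)%:R
      = 7 * 2 ^ (k%:Z + s%:Z - 1) - 7 * 2 ^ (2 * s%:Z)
        + 105 * 2 ^ (4 * s%:Z - 6) - 21 * 2 ^ (3 * s%:Z - 5) :> rat) /\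
   (forall j k : nat, (1 <= j)%N -> (j + 1 <= s)%N -> (s + j + 1 <= k)%N ->
      (Gamma (s + j) s s s k)%:R
      = 147 * (5 * 2 ^ (j%:Z - 1) - 1) * 2 ^ (k%:Z + s%:Z + 3 * j%:Z - 6)
        + 21 * (5 * 2 ^ (4 * s%:Z + 4 * j%:Z - 6)
                - 2 ^ (3 * s%:Z + 3 * j%:Z - 5)
                - (155 * 2 ^ (j%:Z - 1) - 35)
                  * 2 ^ (2 * s%:Z + 4 * j%:Z - 7)) :> rat) /\
   (forall k : nat, (2 * s + 1 <= k)%N ->
      (Gamma (2 * s) s s s k)%:R
      = 7 * 2 ^ (2 * k%:Z + 2 * s%:Z - 2)
        + 21 * (35 * 2 ^ (k%:Z + 5 * s%:Z - 7)
                - 39 * 2 ^ (k%:Z + 4 * s%:Z - 6))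
        + 7 * (15 * 2 ^ (8 * s%:Z - 6) - 465 * 2 ^ (7 * s%:Z - 8)
               + 349 * 2 ^ (6 * s%:Z - 7)) :> rat) /\
   (forall j k : nat, (j + 2 <= s)%N -> (2 * s + 2 + j <= k)%N ->
      (Gamma (2 * s + 1 + j) s s s k)%:R
      = 105 * (2 ^ (2 * k%:Z + 2 * s%:Z + 4 * j%:Z - 2)
               + 7 * 2 ^ (k%:Z + 5 * s%:Z + 4 * j%:Z - 3)
               - 31 * 2 ^ (k%:Z + 4 * s%:Z + 5 * j%:Z - 3))
        + 105 * (2 ^ (8 * s%:Z + 4 * j%:Z - 2)
                 - 31 * 2 ^ (7 * s%:Z + 5 * j%:Z - 3)
                 + 93 * 2 ^ (6 * s%:Z + 6 * j%:Z - 3)) :> rat) /\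
   (forall k : nat, (3 * s <= k)%N ->
      (Gamma (3 * s) s s s k)%:R
      = 2 ^ (3 * k%:Z + 3 * s%:Z - 3) - 7 * 2 ^ (2 * k%:Z + 6 * s%:Z - 6)
        + 7 * 2 ^ (k%:Z + 9 * s%:Z - 8) - 2 ^ (12 * s%:Z - 9) :> rat)) /\
  (* rank i, width i *)
  ((forall i : nat, (1 <= i)%N -> (i <= s + 1)%N ->
      (Gamma i s s s i)%:R
      = 2 ^ (3 * s%:Z + 3 * i%:Z - 3) - 7 * 2 ^ (4 * i%:Z - 6)
        + 3 * 2 ^ (3 * i%:Z - 5) :> rat) /\
   (forall j : nat, (1 <= j)%N -> (j <= s + 1)%N ->
      (Gamma (s + j) s s s (s + j))%:R
      = 2 ^ (6 * s%:Z + 3 * j%:Z - 3) + 7 * 2 ^ (2 * s%:Z + 5 * j%:Z - 8)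
        - 7 * 2 ^ (2 * s%:Z + 4 * j%:Z - 7)
        - 7 * 2 ^ (4 * s%:Z + 4 * j%:Z - 6)
        + 3 * 2 ^ (3 * s%:Z + 3 * j%:Z - 5) :> rat) /\
   (forall j : nat, (j + 1 <= s)%N ->
      (Gamma (2 * s + 1 + j) s s s (2 * s + 1 + j))%:R
      = 2 ^ (9 * s%:Z + 3 * j%:Z) - 7 * 2 ^ (8 * s%:Z + 4 * j%:Z - 2)
        + 7 * 2 ^ (7 * s%:Z + 5 * j%:Z - 3)
        - 2 ^ (6 * s%:Z + 6 * j%:Z - 3) :> rat)) /\
  (* reductions *)
  ((forall j k : nat, (j + 2 <= s)%N -> (2 * s + 2 + j <= k)%N ->
      Gamma (2 * s + 1 + j) s s s k
      = (16 ^ (3 * j)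
         * Gamma (2 * (s - j) + 1) (s - j) (s - j) (s - j) (k - 3 * j))%N) /\
   (forall j : nat, (j + 1 <= s)%N ->
      Gamma (2 * s + 1 + j) s s s (2 * s + 1 + j)
      = (16 ^ (3 * j)
         * Gamma (2 * (s - j) + 1) (s - j) (s - j) (s - j)
             (2 * (s - j) + 1))%N) /\
   (forall k : nat, (3 * s <= k)%N ->
      Gamma (3 * s) s s s k
      = (16 ^ (3 * (s - 1)) * Gamma 3 1 1 1 (k - 3 * (s - 1)))%N)).
Proof.
split; [|split].
- split; [|split; [|split; [|split; [|split; [|split]]]]].
  + case=> [|k]; first by rewrite Gamma_width0.
    by rewrite GammaE // !(@stratum_small _.+1) // stratum0_0 // !add0r.
  + move=> i k i0 hi hk.
    rewrite GammaE ?stratum3_low ?stratum2_low ?stratum1_low ?stratum0_pos; try lia; two_expz; field; exact: isT.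
  + move=> k hk.
    rewrite GammaE ?stratum3_low ?stratum2_low ?stratum1_top ?stratum0_pos; try lia; two_expz; field; exact: isT.
  + move=> j k j0 hj hk.
    rewrite GammaE ?stratum3_mid ?stratum2_mid ?(@stratum_large 1) ?stratum0_pos; try lia; two_expz; field; exact: isT.
  + move=> k hk.
    rewrite GammaE ?stratum3_double ?stratum2_top ?(@stratum_large 1) ?stratum0_pos; try lia; two_expz; field; exact: isT.
  + move=> j k hj hk.
    rewrite Gamma_high ?stratum3_high; try lia; two_expz; field; exact: isT.
  + move=> k hk.
    case: (ltnP (2 * s) (3 * s)) => h; last by exfalso; lia.
    rewrite Gamma_high ?stratum3_top; try lia; two_expz; field; exact: isT.
- split; [|split].
  + move=> i i0 hi.
    rewrite GammaE ?square3_low ?square2_low ?square1_low ?stratum0_pos; try lia; two_expz; field; exact: isT.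
  + move=> j j0 hj.
    rewrite GammaE ?square3_mid ?square2_mid ?(@stratum_large 1) ?stratum0_pos; try lia; two_expz; field; exact: isT.
  + move=> j hj.
    (* The height r = s - j is the one at which rank and width equal 2r + 1; [square3_high] lifts it
       by j steps. *)
    have [r er] : exists r, s = (r + j)%N by apply: leq_addP; lia.
    subst s; have -> : (2 * (r + j) + 1 + j = 2 * r + 1 + 3 * j)%N by lia.
    rewrite Gamma_high ?square3_high; try lia; two_expz; rewrite ?pwD; field; exact: isT.
- split; [|split].
  + move=> j k hj hk; rewrite -Gamma_reduction; try lia.
    by congr Gamma; lia.
  + move=> j hj; rewrite -Gamma_reduction; try lia.
    by congr Gamma; lia.
  + move=> k hk; rewrite -Gamma_reduction; try lia.
    by congr Gamma; lia.
Qed.
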